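(* Let $X$ be a compact Polish space with Borel $\sigma$-field $\mathscr B$ and a Borel probability measure $m$, and let $(T,\mathscr A,p)$ be a probability space. Let $f:T\times X\to X$ be a measurable map, and let $P^n(x,A)$ be the $n$-th transition probabilities of the Markov chain induced by $f$. Assume that for some $n_0\in\mathbb N$, $$P^{n_0}(x,dy)=p(x,y)\,dm(y)\quad\text{for all }x\in X,\qquad\text{and the map } x\in X\mapsto p(x,\cdot)\in L^1(m)\text{ is continuous.}$$ Then $f$ satisfies (FPM).
   Context: Write $f_t=f(t,\cdot)$, $(\Omega,\mathscr F,\mathbb P)=(T^{\mathbb N},\mathscr A^{\mathbb N},p^{\mathbb N})$, and for $\omega=(\omega_1,\omega_2,\dots)\in\Omega$ put $f^0_\omega=\mathrm{id}$, $f^n_\omega=f_{\omega_n}\circ\dots\circ f_{\omega_1}$. The $n$-th transition probability is $P^n(x,A)=\mathbb P(\{\omega: f^n_\omega(x)\in A\})$ for $x\in X$, $A\in\mathscr B$. A probability measure $\mu$ on $(X,\mathscr B)$ is a stationary measure of $f$ if $\mu(A)=\int \mu(f_t^{-1}A)\,dp(t)$ for all $A\in\mathscr B$. It is ergodic if $\mathbb P\times\mu$ is an ergodic invariant measure of the skew product $F(\omega,x)=(\sigma\omega,f_{\omega_1}(x))$ on $\Omega\times X$, where $\sigma$ is the left shift on $\Omega$. (FPM) (finitude of physical measures): there exist finitely many ergodic stationary probability measures $\mu_1,\dots,\mu_r$ of $f$ such that: 1) each $\mu_i$ is absolutely continuous with respect to $m$; 2) they have pairwise disjoint supports up to an $m$-null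 set, where the support of $\mu_i$ is $\{d\mu_i/dm\neq0\}$; 3) for any bounded $\mathscr B$-measurable real-valued function $\psi$ on $X$, $m(B_\omega(\mu_1,\psi)\cup\dots\cup B_\omega(\mu_r,\psi))=1$ for $\mathbb P$-almost every $\omega\in\Omega$, where $B_\omega(\mu_i,\psi)=\{x\in X:\lim_{n\to\infty}\frac1n\sum_{j=0}^{n-1}\psi(f^j_\omega(x))=\int\psi\,d\mu_i\}$. *)

(* Defs.v *)
From HB Require Import structures.
From mathcomp Require Import all_boot all_order all_algebra.
From mathcomp Require Import all_classical all_reals all_analysis.

Set Implicit Arguments.
Unset Strict Implicit.
Unset Printing Implicit Defensive.
Import Order.TTheory GRing.Theory Num.Theory.
Import numFieldNormedType.Exports.

Local Open Scope classical_set_scope.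
Local Open Scope charge_scope.
Local Open Scope ring_scope.

Definition compatible_complete_metric (R : realType) (X : topologicalType)
    (dist : X -> X -> R) : Prop :=
  [/\ forall x y, 0 <= dist x y,
      forall x y, dist x y = 0 <-> x = y,
      forall x y, dist x y = dist y x &
      forall x y z, dist x z <= dist x y + dist y z]
  /\ (forall (x : X) (A : set X),
        nbhs x A <-> exists2 e : R, 0 < e & [set y | dist x y < e] `<=` A)
  /\ (forall u : nat -> X,
        (forall e : R, 0 < e -> exists N : nat, forall i j : nat,
           (N <= i)%N -> (N <= j)%N -> dist (u i) (u j) < e) ->
        exists l : X, u @ \oo --> l).

(* Polish is a property of the topology: a complete metric inducing it is only
   required to exist, and is not part of the structure of [X]. *)
Definition polish (R : realType) (X : topologicalType) : Prop :=
  (exists2 D : set X, countable D & dense D)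
  /\ exists dist : X -> X -> R, compatible_complete_metric dist.

Notation borel X := (g_sigma_algebraType (@open X)).

Definition coordinate_sets d (T : measurableType d) : set (set (nat -> T)) :=
  \bigcup_(k in [set: nat])
    preimage_set_system [set: nat -> T] (fun w => w k) measurable.

(* [T ^ N] with its product sigma-algebra.  Sequences are indexed from 0: the
   coordinate [w k] selects the map applied at time [k + 1]. *)
Notation sequence_space T := (g_sigma_algebraType (@coordinate_sets _ T)).

(* Cylinders form a pi-system generating the sigma-algebra, so [p ^ N] is the
   only probability measure [P] with this property. *)
Definition is_power_measure d (T : measurableType d) (R : realType)
    (p : probability T R) (P : probability (sequence_space T) R) : Prop :=
  forall (n : nat) (A : nat -> set T), (forall k, measurable (A k)) ->
    P [set w | forall k, (k < n)%N -> A k (w k)] = (\prod_(k < n) p (A k))%E.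

Section random_dynamics.
Context d (T : measurableType d) (R : realType) (X : ptopologicalType).
Implicit Types (f : T * borel X -> borel X) (w : sequence_space T).
Implicit Types (p : probability T R) (P : probability (sequence_space T) R).
Implicit Types (m mu : probability (borel X) R) (psi : X -> R).

Fixpoint random_iterate f (n : nat) w (x : X) : X :=
  if n is k.+1 then f (w k, random_iterate f k w x) else x.

Definition transition P f (n : nat) (x : X) (A : set X) : \bar R :=
  P [set w | A (random_iterate f n w x)].

Definition stationary p f mu : Prop :=
  forall A : set (borel X), measurable A ->
    mu A = (\int[p]_t mu [set x | A (f (t, x))])%E.

Definition skew_product f (z : sequence_space T * borel X) :
    sequence_space T * borel X :=
  (fun k => z.1 k.+1, f (z.1 0%N, z.2)).

Definition ergodic_invariant d' (Y : measurableType d')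
    (nu : set Y -> \bar R) (F : Y -> Y) : Prop :=
  (forall A, measurable A -> nu (F @^-1` A) = nu A)
  /\ (forall A, measurable A -> F @^-1` A = A -> nu A = 0%E \/ nu A = 1%E).

Definition ergodic_stationary p P f mu : Prop :=
  stationary p f mu /\ ergodic_invariant (P \x mu)%E (skew_product f).

(* ['d _ '/d m] is a density only when [mu `<< m] (it is [-oo] otherwise), which
   [FPM] requires of every measure this is applied to. *)
Definition density_support m mu : set X :=
  [set x | ('d (charge_of_finite_measure mu) '/d m) x != 0%E].

Definition basin f mu psi w : set X :=
  [set x | (fun n : nat => n%:R^-1 * \sum_(0 <= j < n) psi (random_iterate f j w x))
             @ \oo --> (\int[mu]_y psi y)%R].

Definition FPM p P m f : Prop :=
  exists (r : nat) (mu : 'I_r -> probability (borel X) R),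
    (forall i, ergodic_stationary p P f (mu i))
    /\ (forall i, mu i `<< m)
    /\ (forall i j, i != j ->
          m (density_support m (mu i) `&` density_support m (mu j)) = 0%E)
    /\ (forall psi : borel X -> R,
          measurable_fun [set: borel X] psi -> bounded_fun psi ->
          {ae P, forall w, m (\bigcup_i basin f (mu i) psi w) = 1%E}).

End random_dynamics.

(* Main.v *)
From HB Require Import structures.
Require Import Defs.
From mathcomp Require Import all_boot all_order all_algebra.
From mathcomp Require Import all_classical all_reals all_analysis.
From mathcomp Require Import measurable_realfun ring lra.
Import Order.TTheory GRing.Theory Num.Theory.
Import numFieldNormedType.Exports.
Local Open Scope classical_set_scope.
Local Open Scope ring_scope.

(** Write [U h x] for the mean of [h (f (t, x))] over [t] and call [h] harmonic
when [U h = h].  The hypothesis on the kernel says that [x |-> P^n0 (x, .)] is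
continuous for the total variation distance and that each [P^n0 (x, .)] is
absolutely continuous with respect to [m].  Everything follows from these two
facts, and four ideas carry the argument.

Strong Feller property.  A harmonic [h] with values in [0, 1] satisfies
[h x = \int h dP^n0 (x, .)], hence is continuous ([harmonic_continuous]).  So it
attains its extrema, and the points of a closed absorbing set where it is
maximal form again a closed absorbing set ([argmax_absorbing]).

Finiteness.  By compactness finitely many rows [P^n0 (z, .)] approximate all
the others.  Two disjoint absorbing sets cannot both carry most of the mass of
the same row, so pairwise disjoint families of closed absorbing sets have
bounded cardinality.  Fix a family [C_1, ..., C_r] of maximal cardinality.
Then two closed absorbing subsets of [C_i] always meet, so a harmonic function
is constant on each [C_i] ([harmonic_constant]), and each nonempty closed
absorbing set meets some [C_i] ([maximal_family_meets]).

Ergodic measures.  The averages of the laws of the chain started in [C_i]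
converge setwise along an ultrafilter; the finite approximation makes them
uniformly countably additive, so the limit is a measure [mu_i]
([ultralimit_probability]), and it is stationary, carried by [C_i] and dominated
by [m] ([stationary_on_absorbing]).  If [A] is invariant under the skew product,
then [x |-> P (A_x)] is harmonic, hence equal to a constant [c] on [C_i]; by
invariance [P (A_x /\ B) = c P (B)] for each cylinder [B], so the section [A_x] is
independent of itself and [c = c * c] ([ergodic_on_absorbing]).

Basins.  By the Birkhoff theorem the averages of [psi] converge to
[\int psi dmu_i] almost everywhere for [P \x mu_i].  The probability [h x] that
the averages from [x] converge to one of these [r] values is harmonic and is
equal to [1] on each [C_i].  The set where [h] is minimal is closed and
absorbing, so it meets some [C_i], and [h = 1] everywhere.  The Fubini theorem
exchanges the quantifiers on the point and on the sequence. *)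

Set Implicit Arguments.
Unset Strict Implicit.
Unset Printing Implicit Defensive.

(** * Birkhoff's ergodic theorem *)

Section birkhoff.
Context d (Y : measurableType d) (R : realType) (nu : probability Y R).

Lemma bounded_integrable (h : Y -> R) (b : R) :
  measurable_fun setT h -> (forall y, `|h y| <= b) ->
  nu.-integrable setT (EFin \o h).
Proof.
move=> mh hb; apply: measurable_bounded_integrable => //.
  by rewrite [X in (X < _)%E](probability_setT nu) ltry.
by exists b; split; [exact: num_real|move=> c bc y _ /=; rewrite (le_trans (hb y))// ltW].
Qed.

Variable F : Y -> Y.
Hypothesis mF : measurable_fun setT F.
Hypothesis ergF : ergodic_invariant nu F.

Lemma invariant_Rintegral (h : Y -> R) (b : R) :
  measurable_fun setT h -> (forall y, `|h y| <= b) ->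
  (\int[nu]_y h (F y) = \int[nu]_y h y)%R.
Proof.
move=> mh hb; congr fine.
have := @integral_pushforward _ _ _ _ _ F mF nu setT (EFin \o h).
rewrite preimage_setT => <- //; last 2 first.
- exact/measurable_EFinP.
- by apply: (@bounded_integrable _ b) => //; exact: measurableT_comp.
apply: eq_measure_integral => A mA _; rewrite /pushforward.
exact: ergF.1.
Qed.

Definition birkhoff_sum (g : Y -> R) (n : nat) (y : Y) : R :=
  \sum_(0 <= j < n) g (iter j F y).

Lemma birkhoff_sumS g n y :
  birkhoff_sum g n.+1 y = g y + birkhoff_sum g n (F y).
Proof.
rewrite /birkhoff_sum big_nat_recl//=; congr (_ + _).
by apply: eq_bigr => j _; rewrite -iterS iterSr.
Qed.

Lemma measurable_iter n : measurable_fun setT (iter n F).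
Proof. by elim: n => [|n IH]; [exact: measurable_id|exact: measurableT_comp]. Qed.

Lemma measurable_birkhoff_sum g n :
  measurable_fun setT g -> measurable_fun setT (birkhoff_sum g n).
Proof.
move=> mg; apply: measurable_sum => j.
by apply: measurableT_comp => //; exact: measurable_iter.
Qed.

(** The maximum of the Birkhoff sums of length at most [n], the empty one
included, in the form that makes [birkhoff_max g n.+1 - birkhoff_max g n \o F]
easy to compute. *)
Fixpoint birkhoff_max (g : Y -> R) (n : nat) (y : Y) : R :=
  if n is k.+1 then Num.max 0 (g y + birkhoff_max g k (F y)) else 0.

Lemma birkhoff_max_ge0 g n y : 0 <= birkhoff_max g n y.
Proof. by case: n => //= n; rewrite le_max lexx. Qed.

Lemma birkhoff_sum_le_max g n y : birkhoff_sum g n y <= birkhoff_max g n y.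
Proof.
elim: n y => [|n IH] y; first by rewrite /birkhoff_sum big_geq.
by rewrite birkhoff_sumS /= le_max lerD2l IH orbT.
Qed.

Lemma birkhoff_max_homo g y : {homo birkhoff_max g ^~ y : m n / (m <= n)%N >-> m <= n}.
Proof.
apply: homo_leq => //; first by move=> a b c; exact: le_trans.
move=> n; elim: n y => [|n IH] y; first exact: birkhoff_max_ge0.
by rewrite /= ge_max !le_max lexx/= lerD2l IH orbT.
Qed.

Lemma measurable_birkhoff_max g n :
  measurable_fun setT g -> measurable_fun setT (birkhoff_max g n).
Proof.
move=> mg; elim: n => [|n IH] /=; first exact: measurable_cst.
apply: measurable_maxr; first exact: measurable_cst.
by apply: measurable_funD => //; exact: measurableT_comp.
Qed.

Lemma birkhoff_max_bounded g b n y :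
  (forall y, `|g y| <= b) -> `|birkhoff_max g n y| <= b *+ n.
Proof.
move=> gb; rewrite ger0_norm ?birkhoff_max_ge0//.
have b0 : 0 <= b by rewrite (le_trans _ (gb y)).
elim: n y => [|n IH] y //=; rewrite ge_max mulrn_wge0//= mulrS lerD//.
by rewrite (le_trans (ler_norm _)).
Qed.

(** The set where the sums are unbounded is exactly invariant, so it has measure
[0] or [1].  In the second case [M_n := birkhoff_max g n] tends to infinity almost
everywhere, so that [M_n.+1 - M_n \o F = max (- M_n \o F) g] tends to [g].  These
differences have nonnegative integral by invariance, hence so does [g]. *)
Lemma birkhoff_sum_bounded_above (g : Y -> R) (b : R) :
  measurable_fun setT g -> (forall y, `|g y| <= b) ->
  (\int[nu]_y g y < 0)%R ->
  {ae nu, forall y, exists k : nat, forall n, birkhoff_sum g n y <= k%:R}.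
Proof.
move=> mg gb g0.
pose A := \bigcap_(k in [set: nat]) \bigcup_(n in [set: nat])
  [set y | k%:R < birkhoff_sum g n y].
have mA : measurable A.
  apply: bigcap_measurable; first by exists 0%N.
  move=> k _; apply: bigcup_measurable => n _.
  rewrite -[X in measurable X]setTI.
  by apply: (measurable_fun_ltr (measurable_cst _) (measurable_birkhoff_sum n mg)).
have [B Bb] : exists B : nat, b <= B%:R.
  by exists (Num.truncn b).+1; rewrite ltW// truncnS_gt.
have gB y : `|g y| <= B%:R by exact: le_trans Bb.
have FA : F @^-1` A = A.
  apply/seteqP; split=> y Ay k _.
    have [n _ /= kn] := Ay (k + B)%N I.
    exists n.+1 => //=; rewrite birkhoff_sumS.
    by move: kn (gB y); rewrite natrD ler_norml => ? /andP[? ?]; lra.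
  have [[|n] _ /= kn] := Ay (k + B)%N I.
    by move: kn; rewrite /birkhoff_sum big_geq// ltNge ler0n.
  exists n => //=; move: kn; rewrite birkhoff_sumS.
  by move: (gB y); rewrite natrD ler_norml => /andP[? ?]; lra.
have nA : ~` A `<=` [set y | exists k : nat, forall n, birkhoff_sum g n y <= k%:R].
  move=> y; rewrite /A setC_bigcap => -[k _]; rewrite setC_bigcup => kn.
  by exists k => n; have /negP := kn n I; rewrite -leNgt.
have [A0|A1] := ergF.2 A mA FA.
  exists A; split => // y /= Ny; apply: contrapT => Ay; apply: Ny; exact: nA.
exfalso; move: g0; rewrite ltNge => /negP; apply.
pose D n y := birkhoff_max g n.+1 y - birkhoff_max g n (F y).
have intM n : nu.-integrable setT (EFin \o birkhoff_max g n).
  apply: (@bounded_integrable _ (b *+ n)); first exact: measurable_birkhoff_max.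
  by move=> y; exact: birkhoff_max_bounded.
have intMF n : nu.-integrable setT (EFin \o (birkhoff_max g n \o F)).
  apply: (@bounded_integrable _ (b *+ n)).
    by apply: measurableT_comp => //; exact: measurable_birkhoff_max.
  by move=> y; exact: birkhoff_max_bounded.
have D0 n : (0 <= \int[nu]_y D n y)%R.
  rewrite RintegralB//; last exact: intMF.
  rewrite [X in _ - X](@invariant_Rintegral (birkhoff_max g n) (b *+ n)); last 2 first.
  - exact: measurable_birkhoff_max.
  - by move=> y; exact: birkhoff_max_bounded.
  rewrite subr_ge0; apply: le_Rintegral => // y _.
  exact: birkhoff_max_homo.
have DE n y : D n y = Num.max (- birkhoff_max g n (F y)) (g y).
  by rewrite /D /= addr_maxl add0r addrK.
have mD n : measurable_fun setT (D n).
  apply: measurable_funB; first exact: measurable_birkhoff_max.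
  by apply: measurableT_comp => //; exact: measurable_birkhoff_max.
have Dg : {ae nu, forall y, setT y -> (EFin \o D n) y @[n --> \oo] --> (EFin \o g) y}.
  exists (~` A); split.
  - exact: measurableC.
  - by rewrite [LHS](probability_setC nu)// [nu A]A1 subee.
  apply: subsetC => y Ay _.
  have Ay' : (F @^-1` A) y by rewrite FA.
  have [n0 _ /= Bn] := Ay' B I.
  apply: cvg_near_cst; exists n0 => // n /= n0n.
  congr EFin; rewrite DE; apply/max_idPr.
  have := birkhoff_max_homo g (F y) n0n.
  have := birkhoff_sum_le_max g n0 (F y).
  by move: (gB y); rewrite ler_norml => /andP[? ?]; lra.
have mg' : measurable_fun setT (EFin \o g) by exact/measurable_EFinP.
have mD' n : measurable_fun setT (EFin \o D n) by exact/measurable_EFinP.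
have ib : nu.-integrable setT (cst b%:E).
  by apply: (finite_measure_integrable_cst nu b measurableT).
have Db : {ae nu, forall y (n : nat), setT y -> (`|(EFin \o D n) y| <= cst b%:E y)%E}.
  apply: aeW => y n _; rewrite lee_fin DE.
  have := birkhoff_max_ge0 g n (F y).
  move: (gb y); rewrite !ler_norml => /andP[? ?] ?; apply/andP; split.
    by rewrite le_max; apply/orP; right.
  by rewrite ge_max; apply/andP; split => //; lra.
have [ig _ lim] := dominated_convergence measurableT mD' mg' Dg ib Db.
have {}lim : (\int[nu]_y D n y)%R @[n --> \oo] --> (\int[nu]_y g y)%R.
  apply: fine_cvg; rewrite fineK//; exact: integrable_fin_num.
by rewrite -(cvg_lim _ lim)//; apply: limr_ge; [exact: cvgP lim|exact: nearW].
Qed.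

(** The sums of [h - (c + e / 2)], where [c] is the mean of [h], are bounded
above almost everywhere, and a bounded quantity is eventually at most
[n * (e / 2)]. *)
Lemma birkhoff_limsup (h : Y -> R) (b e : R) :
  measurable_fun setT h -> (forall y, `|h y| <= b) -> 0 < e ->
  {ae nu, forall y, \forall n \near \oo,
     n%:R^-1 * birkhoff_sum h n y <= (\int[nu]_y h y)%R + e}.
Proof.
move=> mh hb e0; set c := (\int[nu]_y h y)%R.
pose g y := h y - (c + e / 2).
have ih : nu.-integrable setT (EFin \o h) by exact: bounded_integrable hb.
have ic : nu.-integrable setT (EFin \o (fun=> c + e / 2)).
  exact: (finite_measure_integrable_cst nu (c + e / 2) measurableT).
have mg : measurable_fun setT g.
  by apply: measurable_funB => //; exact: measurable_cst.
have gb y : `|g y| <= b + `|c + e / 2|.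
  by rewrite (le_trans (ler_normB _ _))// lerD2r.
have /(birkhoff_sum_bounded_above mg gb) : (\int[nu]_y g y < 0)%R.
  rewrite RintegralB// Rintegral_cst//
    [X in fine X](probability_setT nu) mulr1.
  by rewrite -/c; lra.
have gE n y : birkhoff_sum g n y = birkhoff_sum h n y - (c + e / 2) * n%:R.
  by rewrite /birkhoff_sum /g sumrB sumr_const_nat subn0 mulr_natr.
apply: filterS => y [k kg].
near=> n.
have n0 : (0 < n%:R :> R) by rewrite ltr0n; near: n; exists 1%N.
rewrite mulrC ler_pdivrMr//.
have := kg n; rewrite gE => kn.
have : k%:R <= e / 2 * n%:R.
  rewrite mulrC -ler_pdivrMr ?divr_gt0//; near: n.
  exact: nbhs_infty_ger.
rewrite mulrDl => ?.
by have -> : e * n%:R = e / 2 * n%:R + e / 2 * n%:R; [field|move: kn; rewrite mulrDl => ?; lra].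
Unshelve. all: by end_near. Qed.

Theorem birkhoff (h : Y -> R) (b : R) :
  measurable_fun setT h -> (forall y, `|h y| <= b) ->
  {ae nu, forall y, n%:R^-1 * birkhoff_sum h n y @[n --> \oo]
                    --> (\int[nu]_y h y)%R}.
Proof.
move=> mh hb.
have mNh : measurable_fun setT (\- h) by exact: measurableT_comp.
have hNb y : `|(\- h) y| <= b by rewrite normrN.
have up : {ae nu, forall y, forall k : nat, \forall n \near \oo,
     n%:R^-1 * birkhoff_sum h n y <= (\int[nu]_y h y)%R + k.+1%:R^-1}.
  by apply: ae_foralln => k; apply: birkhoff_limsup hb _ => //; rewrite invr_gt0.
have lo : {ae nu, forall y, forall k : nat, \forall n \near \oo,
     n%:R^-1 * birkhoff_sum (\- h) n y <= (\int[nu]_y (\- h) y)%R + k.+1%:R^-1}.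
  by apply: ae_foralln => k; apply: birkhoff_limsup hNb _ => //; rewrite invr_gt0.
have IN : (\int[nu]_y (\- h) y = - \int[nu]_y h y)%R.
  under eq_Rintegral do rewrite /= -mulN1r.
  by rewrite RintegralZl ?mulN1r//; exact: bounded_integrable hb.
have SN n y : birkhoff_sum (\- h) n y = - birkhoff_sum h n y.
  by rewrite /birkhoff_sum sumrN.
apply: filterS2 up lo => y up lo.
apply/cvgrPdist_le => e e0.
have [k ke] : exists k : nat, k.+1%:R^-1 < e.
  by have [k _ /(_ k (leqnn k))] := near_infty_natSinv_lt (PosNum e0); exists k.
near=> n.
have : n%:R^-1 * birkhoff_sum h n y <= (\int[nu]_y h y)%R + k.+1%:R^-1.
  by near: n; exact: up.
have : n%:R^-1 * birkhoff_sum (\- h) n y <= (\int[nu]_y (\- h) y)%R + k.+1%:R^-1.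
  by near: n; exact: lo.
rewrite IN SN mulrN ler_norml => lon upn.
move: lon upn ke; move: (n%:R^-1 * _) (k.+1%:R^-1) => u r ? ? ?.
apply/andP; split; lra.
Unshelve. all: by end_near. Qed.
End birkhoff.

(** * Setwise convergence of probability measures *)

(** The number of integers in [1, k] that are at most [y] is the floor of [y]. *)
Lemma count_levels (R : realType) (k : nat) (y : R) : 0 <= y -> y <= k%:R ->
  (\sum_(i < k) (i.+1%:R <= y)%R%:R : R) <= y <=
  (\sum_(i < k) (i.+1%:R <= y)%R%:R : R) + 1.
Proof.
move=> y0; elim: k => [|k IH] yk; first by rewrite big_ord0; lra.
rewrite big_ord_recr/=; have [yk'|ky] := leP y k%:R.
  have -> : (k.+1%:R <= y) = false.
    by apply/negbTE; rewrite -ltNge (le_lt_trans yk')// ltr_nat.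
  by rewrite addr0; exact: IH.
have -> : \sum_(i < k) (i.+1%:R <= y)%R%:R = k%:R :> R.
  rewrite (eq_bigr (fun=> 1)) ?sumr_const ?card_ord// => i _.
  by rewrite (_ : _ <= y) // (le_trans _ (ltW ky))// ler_nat.
move: yk; rewrite -natr1.
by case: (leP (k%:R + 1) y) => /= ? ?; lra.
Qed.

Section setwise.
Context d (Y : measurableType d) (R : realType).

Definition unit_fun (h : Y -> R) :=
  measurable_fun setT h /\ forall y, 0 <= h y <= 1.

Lemma unit_fun_norm h : unit_fun h -> forall y, `|h y| <= 1.
Proof. by move=> [_ h1] y; have := h1 y; rewrite ler_norml => /andP[? ->]; rewrite andbT; lra. Qed.

Lemma unit_fun_integrable (nu : probability Y R) h :
  unit_fun h -> nu.-integrable setT (EFin \o h).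
Proof. by move=> uh; exact: bounded_integrable uh.1 (unit_fun_norm uh). Qed.

Lemma measurable_level (h : Y -> R) (a : R) :
  measurable_fun setT h -> measurable [set y | a <= h y].
Proof.
move=> mh; rewrite -[X in measurable X]setTI.
exact: (measurable_fun_ler (measurable_cst _) mh).
Qed.

(** Discrete layer-cake formula: [h] differs by at most [1 / k.+1] from the
average of the indicators of its upper level sets.  It reduces statements about
integrals to statements about finitely many sets, with an error that does not
depend on the measure. *)
Lemma layer_approximation (nu : probability Y R) (h : Y -> R) (k : nat) :
  unit_fun h ->
  `|(\int[nu]_y h y)%R - k.+1%:R^-1 * \sum_(i < k.+1)
     fine (nu [set y | i.+1%:R / k.+1%:R <= h y])| <= k.+1%:R^-1.
Proof.
move=> uh; have [mh h1] := uh.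
have k0 : 0 < k.+1%:R :> R by rewrite ltr0n.
pose A (i : nat) := [set y | i.+1%:R / k.+1%:R <= h y].
have mA i : measurable (A i) by exact: measurable_level.
pose s y := k.+1%:R^-1 * \sum_(i < k.+1) \1_(A i) y : R.
have is_ : nu.-integrable setT (EFin \o (fun y => \sum_(i < k.+1) \1_(A i) y : R)).
  apply: (@bounded_integrable _ _ _ _ _ k.+1%:R).
    by apply: measurable_sum => i; exact: measurable_indic.
  move=> y; rewrite (le_trans (ler_norm_sum _ _ _))//.
  have -> : k.+1%:R = \sum_(i < k.+1) 1 :> R by rewrite sumr_const card_ord.
  apply: ler_sum => i _.
  by rewrite indicE; case: (y \in _); rewrite ?normr1 ?normr0.
have -> : k.+1%:R^-1 * \sum_(i < k.+1) fine (nu (A i)) = (\int[nu]_y s y)%R.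
  rewrite /s RintegralZl//; congr (_ * _).
  rewrite /Rintegral; under eq_integral do rewrite -sumEFin.
  rewrite integral_sum//=; last first.
    move=> i; apply: (@bounded_integrable _ _ _ _ _ 1).
      exact: measurable_indic.
    by move=> y; rewrite indicE; case: (y \in _); rewrite ?normr1 ?normr0.
  rewrite -sum_fine; last first.
    by move=> i _; rewrite integral_indic// setIT; exact: fin_num_measure.
  by apply: eq_bigr => i _; rewrite integral_indic// setIT.
have sh y : s y <= h y <= s y + k.+1%:R^-1.
  have /andP[h0 h1'] := h1 y.
  have := @count_levels R k.+1 (k.+1%:R * h y).
  rewrite mulr_ge0// ler_piMr// => /(_ isT isT).
  have -> : \sum_(i < k.+1) (i.+1%:R <= k.+1%:R * h y)%R%:R =
      \sum_(i < k.+1) \1_(A i) y :> R.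
    apply: eq_bigr => i _; rewrite indicE mulrC -ler_pdivrMr//.
    by congr ((nat_of_bool _)%:R); apply/idP/idP; [move=> ?; exact/mem_set|move/set_mem].
  move=> /andP[sl su]; rewrite /s mulrC ler_pdivrMr// [h y * _]mulrC sl/=.
  by rewrite -[X in _ / _ + X]mul1r -mulrDl ler_pdivlMr// mulrC.
have shd y : `|h y - s y| <= k.+1%:R^-1.
  have /andP[ys yu] := sh y.
  by rewrite ler_distl yu andbT (le_trans _ ys)// gerDl oppr_le0 invr_ge0 ltW.
have ih := unit_fun_integrable nu uh.
have is2 : nu.-integrable setT (EFin \o s).
  by rewrite /s; apply: (integrableZl measurableT (k.+1%:R^-1) is_).
rewrite -RintegralB//.
rewrite (le_trans (le_normr_Rintegral _ _))//.
  exact: (integrableB measurableT ih is2).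
have <- : (\int[nu]_y (cst k.+1%:R^-1 y) = k.+1%:R^-1)%R.
  by rewrite Rintegral_cst// [X in fine X](probability_setT nu) mulr1.
apply: le_Rintegral => //.
  apply: (@bounded_integrable _ _ _ _ _ (k.+1%:R^-1)).
    apply: measurableT_comp => //; apply: measurable_funB => //.
    by apply: measurable_funM => //; apply: measurable_sum => i; exact: measurable_indic.
  by move=> y; rewrite /= normr_id.
exact: (finite_measure_integrable_cst nu _ measurableT).
Qed.

Lemma setwise_cvg_Rintegral (I : Type) (F : set_system I) (FF : ProperFilter F)
    (nu : I -> probability Y R) (mu : probability Y R) (h : Y -> R) :
  unit_fun h ->
  (forall A, measurable A -> fine (nu i A) @[i --> F] --> fine (mu A)) ->
  (\int[nu i]_y h y)%R @[i --> F] --> (\int[mu]_y h y)%R.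
Proof.
move=> uh numu; apply/cvgrPdist_lt => e e0.
have [k ke] : exists k : nat, k.+1%:R^-1 < e / 3.
  have e3 : 0 < e / 3 by rewrite divr_gt0.
  by have [k _ /(_ k (leqnn k))] := near_infty_natSinv_lt (PosNum e3); exists k.
pose S (m : probability Y R) := k.+1%:R^-1 * \sum_(i < k.+1)
     fine (m [set y | i.+1%:R / k.+1%:R <= h y]).
have : S (nu i) @[i --> F] --> S mu.
  apply: cvgMl_tmp; apply: cvg_big => [|i _]; first exact: add_continuous.
  by apply: numu; exact: measurable_level uh.1.
have e3 : 0 < e / 3 by rewrite divr_gt0.
move=> /cvgrPdist_lt/(_ _ e3); apply: filterS => i Si.
have := layer_approximation mu k uh; have := layer_approximation (nu i) k uh.
rewrite -/(S mu) -/(S (nu i)) => Li Lm.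
rewrite (_ : _ - _ = ((\int[mu]_y h y)%R - S mu) + (S mu - S (nu i)) -
  ((\int[nu i]_y h y)%R - S (nu i))); last by ring.
rewrite (le_lt_trans (ler_normB _ _))//.
have := ler_normD ((\int[mu]_y h y)%R - S mu) (S mu - S (nu i)).
move: Si Li Lm ke; move: (k.+1%:R^-1) => r Si Li Lm re ?.
lra.
Qed.

End setwise.

(** * Averages and ultralimits of probability measures *)

(** A cluster point of an ultrafilter is its limit. *)
Lemma ultrafilter_cvg_unit (R : realType) (I : Type) (G : set_system I)
    (GU : UltraFilter G) (u : I -> R) :
  (forall i, 0 <= u i <= 1) -> cvg (u i @[i --> G]).
Proof.
move=> u01.
have PG : ProperFilter G by exact: ultra_proper.
have [|l [_ cl]] := @segment_compact R 0 1 (u i @[i --> G]).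
  by apply: (@filterE _ G) => i; rewrite /= in_itv; exact: u01.
apply/cvg_ex; exists l => V Vl.
have [//|nV] := in_ultra_setVsetC (u @^-1` V) GU.
by have [y [/= ]] := cl (~` V) V nV Vl.
Qed.

Section cesaro.
Context d (Y : measurableType d) (R : realType) (nu : nat -> probability Y R).

Definition cesaro (n : nat) : set Y -> \bar R :=
  mscale (n.+1%:R^-1)%:nng (msum nu n.+1).

HB.instance Definition _ n := Measure.on (cesaro n).

Let cesaro_sum n A :
  cesaro n A = ((n.+1%:R^-1)%:E * \sum_(k < n.+1) nu k A)%E.
Proof. by []. Qed.

Let cesaro_setT n : cesaro n setT = 1%E.
Proof.
rewrite cesaro_sum (eq_bigr (fun=> 1%:E)) => [|i _].
  by rewrite sumEFin sumr_const card_ord -EFinM mulVf.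
exact: probability_setT.
Qed.

HB.instance Definition _ n :=
  Measure_isProbability.Build _ _ _ (cesaro n) (cesaro_setT n).

Lemma cesaroE n A : measurable A ->
  fine (cesaro n A) = n.+1%:R^-1 * \sum_(k < n.+1) fine (nu k A).
Proof.
move=> mA; rewrite cesaro_sum sum_fine.
  rewrite fineM// sum_fin_num; apply/allP => _ /mapP[k _ ->].
  exact: fin_num_measure.
by move=> k _; exact: fin_num_measure.
Qed.

Lemma integral_cesaro n h : unit_fun h ->
  (\int[cesaro n]_y h y)%R =
  n.+1%:R^-1 * \sum_(k < n.+1) (\int[nu k]_y h y)%R.
Proof.
move=> uh; have [mh h01] := uh.
have mh' : measurable_fun setT (EFin \o h) by exact/measurable_EFinP.
have h0 y : (0 <= (h y)%:E)%E by rewrite lee_fin; case/andP: (h01 y).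
rewrite /Rintegral ge0_integral_mscale// ge0_integral_measure_sum//.
have fk k : (\int[nu k]_y (h y)%:E)%E \is a fin_num.
  exact: (integrable_fin_num measurableT (unit_fun_integrable (nu k) uh)).
have fs : (\sum_(k < n.+1) \int[nu k]_y (h y)%:E)%E \is a fin_num.
  by rewrite sum_fin_num; apply/allP => _ /mapP[k _ ->]; exact: fk.
by rewrite fineM//= sum_fine.
Qed.
End cesaro.

(** A setwise limit of probability measures is finitely additive in general;
the uniform continuity at the empty set assumed here makes it a measure. *)
Section ultralimit.
Context d (Y : measurableType d) (R : realType) (nu : nat -> probability Y R).
Variables (G : set_system nat) (GU : UltraFilter G).
Hypothesis equicontinuous : forall A : (set Y)^nat,
  (forall j, measurable (A j)) -> nonincreasing_seq A -> \bigcap_j A j = set0 ->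
  forall e : R, 0 < e -> exists j, forall n, fine (nu n (A j)) <= e.

Let PG : ProperFilter G. Proof. exact: ultra_proper. Qed.

Let l A : R := lim (fine (nu n A) @[n --> G]).

Let fine01 n A : measurable A -> 0 <= fine (nu n A) <= 1.
Proof.
move=> mA; rewrite fine_ge0//= -lee_fin fineK; first exact: probability_le1.
exact: fin_num_measure.
Qed.

Let cvg_l A : measurable A -> fine (nu n A) @[n --> G] --> l A.
Proof. by move=> mA; apply: ultrafilter_cvg_unit => n; exact: fine01. Qed.

Let l_ge0 A : measurable A -> 0 <= l A.
Proof.
move=> mA; apply: limr_ge; first exact: cvgP (cvg_l mA).
by apply: nearW => n; case/andP: (fine01 n mA).
Qed.

Let l_le A e : measurable A -> (forall n, fine (nu n A) <= e) -> l A <= e.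
Proof.
by move=> mA Ae; apply: limr_le; [exact: cvgP (cvg_l mA)|exact: nearW].
Qed.

Let lU A B : measurable A -> measurable B -> [disjoint A & B] ->
  l (A `|` B) = l A + l B.
Proof.
move=> mA mB AB; apply/cvg_lim => //.
rewrite (_ : (fun n => _) = (fun n => fine (nu n A) + fine (nu n B))).
  by apply: cvgD; exact: cvg_l.
apply/funext => n; rewrite measureU//; first by rewrite fineD// fin_num_measure.
exact/disj_set2P.
Qed.

Let lT : l setT = 1.
Proof.
apply/cvg_lim => //; rewrite (_ : (fun n => _) = fun=> 1); first exact: cvg_cst.
by apply/funext => n; rewrite probability_setT.
Qed.

Let l0 : l set0 = 0.
Proof.
apply/cvg_lim => //; rewrite (_ : (fun n => _) = fun=> 0); first exact: cvg_cst.
by apply/funext => n; rewrite measure0.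
Qed.

(** The absolute value only serves for sets that are not measurable, on which
the limit may fail to exist. *)
Let mu A : \bar R := `|l A|%:E.

Let muE A : measurable A -> mu A = (l A)%:E.
Proof. by move=> mA; rewrite /mu ger0_norm// l_ge0. Qed.

Let mu0 : mu set0 = 0%E. Proof. by rewrite muE// l0. Qed.

Let mu_ge0 A : (0 <= mu A)%E. Proof. by rewrite lee_fin. Qed.

Let mu_sigma_additive : semi_sigma_additive mu.
Proof.
move=> F mF tF mUF.
pose Tl N := \bigcup_(i in [set i | (N <= i)%N]) F i.
have mT N : measurable (Tl N) by apply: bigcup_measurable => i _; exact: mF.
have TlS N : Tl N = F N `|` Tl N.+1.
  apply/seteqP; split => y.
    move=> [i /= Ni Fi]; move: Ni; rewrite leq_eqVlt => /predU1P[Ni|Ni].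
      by left; rewrite Ni.
    by right; exists i.
  by move=> [Fy|[i /= Ni Fi]]; [exists N => /=|exists i => //=; exact: ltnW].
have TlD N : [disjoint F N & Tl N.+1].
  apply/disj_set2P/seteqP; split => // y [FN [i /= Ni Fi]].
  have := tF N i I I (ex_intro _ y (conj FN Fi)).
  by move=> Ne; subst i; rewrite ltnn in Ni.
have lsum N : l (\bigcup_n F n) = \sum_(0 <= i < N) l (F i) + l (Tl N).
  elim: N => [|N ->].
    rewrite big_geq// add0r; congr l; apply/seteqP; split => y [i _ Fi];
    by exists i.
  by rewrite big_nat_recr//= -addrA TlS lU.
have cap0 : \bigcap_N Tl N = set0.
  apply/seteqP; split => // y Ty; have [i _ Fi] := Ty 0%N I.
  have [j /= ij Fj] := Ty i.+1 I.
  have := tF i j I I (ex_intro _ y (conj Fi Fj)).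
  by move=> ije; subst j; rewrite ltnn in ij.
have niT : nonincreasing_seq Tl.
  move=> a b ab; apply/subsetPset => y [i /= bi Fi].
  by exists i => //=; exact: leq_trans bi.
rewrite muE//.
rewrite (_ : (fun n => _) = (fun n => (\sum_(0 <= i < n) l (F i))%:E)); last first.
  apply/funext => n; rewrite -sumEFin; apply: eq_bigr => i _; exact: muE.
apply: cvg_EFin; first exact: nearW.
apply/cvgrPdist_le => e e0; have [J HJ] := equicontinuous mT niT cap0 e0.
exists J => // n /= Jn; rewrite (lsum n) [_ + l _]addrC addrK ger0_norm ?l_ge0//.
apply: l_le => // k; apply: le_trans (HJ k).
apply: fine_le; [exact: fin_num_measure..|].
by apply: le_measure; rewrite ?inE//; exact/subsetPset/niT.
Qed.

HB.instance Definition _ := isMeasure.Build _ _ _ mu mu0 mu_ge0 mu_sigma_additive.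

Let mu_setT : mu setT = 1%E. Proof. by rewrite muE// lT. Qed.

HB.instance Definition _ := Measure_isProbability.Build _ _ _ mu mu_setT.

Lemma ultralimit_probability : exists m : probability Y R,
  forall A, measurable A -> fine (nu n A) @[n --> G] --> fine (m A).
Proof.
exists mu => A mA; have lA : l A = fine (mu A) by rewrite muE.
by have := cvg_l mA; rewrite [X in _ --> X]lA.
Qed.
End ultralimit.

(** * The space of noise sequences *)

Section image_law.
Context d1 d2 (Y : measurableType d1) (Z : measurableType d2) (R : realType).
Variables (nu : probability Y R) (g : Y -> Z) (mg : measurable_fun setT g).

Definition image_law : probability Z R :=
  distribution nu (mfun_Sub (mem_set mg)).

Lemma integral_image_law (h : Z -> \bar R) :
  measurable_fun setT h -> (forall z, 0 <= h z)%E ->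
  (\int[image_law]_z h z = \int[nu]_y h (g y))%E.
Proof.
move=> mh h0.
have := @ge0_integral_pushforward _ _ _ _ _ g mg nu setT h measurableT mh.
by rewrite preimage_setT; apply => z _; exact: h0.
Qed.
End image_law.

Lemma product_measure_swap d1 d2 (Y : measurableType d1) (Z : measurableType d2)
    (R : realType) (nu : probability Y R) (mu : probability Z R) A :
  measurable A -> (nu \x mu)%E A = (\int[mu]_z nu (ysection A z))%E.
Proof.
move=> mA.
by rewrite (@product_measure_unique _ _ _ _ _ nu mu
  [the measure _ _ of (nu \x^ mu)%E])// => B C mB mC; exact: product_measure2E.
Qed.

Section sequence_space.
Context d (T : measurableType d).

Definition cylinder (n : nat) (A : nat -> set T) : set (sequence_space T) :=
  [set w | forall k, (k < n)%N -> A k (w k)].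

Lemma measurable_coordinate (k : nat) :
  measurable_fun setT (fun w : sequence_space T => w k).
Proof.
move=> _ A mA; apply: sub_sigma_algebra; exists k => //; exists A => //.
Qed.

Lemma measurable_to_sequences d' (Y : measurableType d') (g : Y -> sequence_space T) :
  (forall k, measurable_fun setT (fun y => g y k)) -> measurable_fun setT g.
Proof.
move=> mg; apply: (@measurability _ _ _ (sequence_space T) _ g (@coordinate_sets d T)) => //.
move=> _ [_ [k _ [A mA <-]] <-].
by have := mg k measurableT A mA; rewrite !setTI.
Qed.

Lemma measurable_cylinder n A :
  (forall k, measurable (A k)) -> measurable (cylinder n A).
Proof.
move=> mA.
have -> : cylinder n A = \bigcap_(k in [set k | (k < n)%N])
    ((fun w : sequence_space T => w k) @^-1` A k) by [].
apply: bigcap_measurableType => k _.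
by rewrite -[X in measurable X]setTI; exact: measurable_coordinate.
Qed.

Lemma power_measure_unique (R : realType)
    (m1 m2 : {measure set (sequence_space T) -> \bar R}) :
  (m1 setT < +oo)%E ->
  (forall n A, (forall k, measurable (A k)) ->
     m1 (cylinder n A) = m2 (cylinder n A)) ->
  forall B, measurable B -> m1 B = m2 B.
Proof.
move=> m1oo m12.
pose G := [set B | exists n A, (forall k : nat, measurable (A k : set T)) /\
  B = cylinder n A].
have mG : measurable = <<s G >> :> set (set (sequence_space T)).
  apply/seteqP; split; last first.
    apply: smallest_sub; first exact: sigma_algebra_measurable.
    by move=> _ [n [A [mA ->]]]; exact: measurable_cylinder.
  apply: smallest_sub; first exact: smallest_sigma_algebra.
  move=> _ [k _ [A mA <-]]; apply: sub_sigma_algebra.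
  exists k.+1, (fun i => if i == k then A else setT); split.
    by move=> i; case: ifP.
  rewrite setTI; apply/seteqP; split => w /=.
    by move=> Awk i _; case: eqP => // ->.
  by move=> /(_ k (ltnSn k)); rewrite eqxx.
have GT : G setT.
  exists 0%N, (fun=> setT); split => //.
  by apply/seteqP; split => // w _ k.
apply: (measure_unique G (fun=> setT)) => //.
- move=> _ _ [n [A [mA ->]]] [n' [A' [mA' ->]]].
  exists (maxn n n'), (fun k => (if (k < n)%N then A k else setT) `&`
    (if (k < n')%N then A' k else setT)); split.
    by move=> k; apply: measurableI; case: ifP.
  apply/seteqP; split => w /=.
    move=> [Aw A'w] k _.
    by split; [case: ifP => // /Aw|case: ifP => // /A'w].
  move=> Aw; split => k kn.
    by have := Aw k; rewrite leq_max kn => /(_ isT)[].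
  by have := Aw k; rewrite leq_max kn orbT => /(_ isT)[].
- by apply/seteqP; split => // w _; exists 0%N.
- by move=> _ [n [A [mA ->]]]; exact: m12.
Qed.

Definition scons (t : T) (w : sequence_space T) : sequence_space T :=
  fun k => if k is k'.+1 then w k' else t.

Lemma measurable_scons :
  measurable_fun setT (fun z : T * sequence_space T => scons z.1 z.2).
Proof.
apply: measurable_to_sequences => -[|k] /=; first exact: measurable_fst.
apply: (measurableT_comp (measurable_coordinate k)); exact: measurable_snd.
Qed.

Context (R : realType) (p : probability T R)
  (P : probability (sequence_space T) R) (P_power : is_power_measure p P).

(** Independence of the first coordinate and of the shifted sequence: under
[p \x P] the concatenated sequence gives the same mass as [P] to each
cylinder, and cylinders determine the measure. *)
Lemma power_split B : measurable B ->
  P B = ((p \x P) [set z | B (scons z.1 z.2)])%E.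
Proof.
move: B; apply: (@power_measure_unique _ P (image_law (p \x P)%E measurable_scons)).
  by rewrite [X in (X < _)%E](probability_setT P) ltry.
move=> n A mA; rewrite [LHS]P_power//.
rewrite /image_law /= /distribution /pushforward /=.
case: n => [|n].
  rewrite big_ord0 (_ : _ @^-1` _ = setT) ?probability_setT//.
  by apply/seteqP; split => // z _ k.
rewrite (_ : _ @^-1` _ = A 0%N `*` cylinder n (fun k => A k.+1)); last first.
  apply/seteqP; split => [z Az|z [A0 Az]].
    by split => [|k kn]; [exact: (Az 0%N)|exact: (Az k.+1)].
  by move=> [|k] //= kn; exact: Az.
rewrite product_measure1E//; last by apply: measurable_cylinder.
by rewrite big_ord_recl; congr (_ * _)%E; have := (P_power n (fun k => mA k.+1)).
Qed.

Lemma power_integral (h : sequence_space T -> \bar R) :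
  measurable_fun setT h -> (forall w, 0 <= h w)%E ->
  (\int[P]_w h w = \int[p]_t \int[P]_w h (scons t w))%E.
Proof.
move=> mh h0.
rewrite -(fubini_tonelli1 (fun z => h (scons z.1 z.2)))//; last first.
  exact: measurableT_comp measurable_scons.
rewrite -(integral_image_law (p \x P)%E measurable_scons)//.
by apply: eq_measure_integral => A mA _; exact: power_split.
Qed.

End sequence_space.

(** * The Markov chain, its harmonic functions and absorbing sets *)

Section markov.
Context d (T : measurableType d) (R : realType) (X : ptopologicalType).
Variables (p : probability T R) (P : probability (sequence_space T) R).
Hypothesis P_power : is_power_measure p P.
Variable f : T * borel X -> borel X.
Hypothesis mf : measurable_fun setT f.

Lemma measurable_closed (C : set X) : closed C -> measurable (C : set (borel X)).
Proof.
move=> cC; rewrite -[C]setCK; apply: measurableC.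
by apply: sub_sigma_algebra; exact: closed_openC.
Qed.

(** [random_iterate] composes the last map outermost; this is the recursion on
the first map, which the Markov property needs. *)
Lemma random_iterate_scons n t w x :
  random_iterate f n.+1 (scons t w) x = random_iterate f n w (f (t, x)).
Proof. by elim: n => //= n ->. Qed.

Lemma measurable_random_iterate n :
  measurable_fun setT (fun z : sequence_space T * borel X =>
    random_iterate f n z.1 z.2 : borel X).
Proof.
elim: n => [|n IH] /=; first exact: measurable_snd.
apply: (measurableT_comp mf); apply: measurable_fun_pair => //.
by apply: (measurableT_comp (measurable_coordinate n)); exact: measurable_fst.
Qed.

Lemma measurable_random_iterate1 n (x : X) :
  measurable_fun setT (fun w : sequence_space T => random_iterate f n w x : borel X).
Proof.
exact: (measurable_fun_pair1 (x : borel X) (measurable_random_iterate n)).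
Qed.

Definition law n (x : X) : probability (borel X) R :=
  image_law P (measurable_random_iterate1 n x).

Lemma lawE n x A : law n x A = transition P f n x A. Proof. by []. Qed.

(** The operator [U^n], with values in the extended reals so that the
Fubini-Tonelli theorem needs no integrability. *)
Definition expect n (h : borel X -> \bar R) (x : borel X) : \bar R :=
  (\int[P]_w h (random_iterate f n w x))%E.

Lemma expect_law n h x : measurable_fun setT h -> (forall y, 0 <= h y)%E ->
  expect n h x = (\int[law n x]_y h y)%E.
Proof. by move=> mh h0; rewrite integral_image_law. Qed.

Lemma expect_indic n A x : measurable A ->
  expect n (EFin \o \1_A) x = transition P f n x A.
Proof.
move=> mA; rewrite expect_law//; first by rewrite integral_indic// setIT.
  by apply/measurable_EFinP; exact: measurable_indic.
by move=> y; rewrite lee_fin.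
Qed.

Lemma expect_ge0 n h x : (forall y, 0 <= h y)%E -> (0 <= expect n h x)%E.
Proof. by move=> h0; apply: integral_ge0. Qed.

Lemma measurable_expect n h : measurable_fun setT h -> (forall y, 0 <= h y)%E ->
  measurable_fun setT (expect n h).
Proof.
move=> mh h0.
apply: (measurable_fun_fubini_tonelli_G (m1 := P)
  (fun z : sequence_space T * borel X => h (random_iterate f n z.1 z.2))) => //.
exact: measurableT_comp (measurable_random_iterate n).
Qed.

Lemma expect0 h x : expect 0 h x = h x.
Proof. by rewrite /expect /= integral_cst// [X in (_ * X)%E](probability_setT P) mule1. Qed.

Lemma expectS n h x : measurable_fun setT h -> (forall y, 0 <= h y)%E ->
  expect n.+1 h x = (\int[p]_t expect n h (f (t, x)))%E.
Proof.
move=> mh h0; rewrite /expect (power_integral P_power)//; last first.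
  by apply: (measurableT_comp mh); exact: measurable_random_iterate1.
by apply: eq_integral => t _; apply: eq_integral => w _; rewrite random_iterate_scons.
Qed.

(** The Chapman-Kolmogorov equation [U^(n + k) = U^k U^n]. *)
Lemma expectD n k h x : measurable_fun setT h -> (forall y, 0 <= h y)%E ->
  expect (n + k) h x = expect k (expect n h) x.
Proof.
move=> mh h0; elim: k x => [|k IH] x; first by rewrite addn0 expect0.
rewrite addnS !expectS//; first by apply: eq_integral => t _; rewrite IH.
- exact: measurable_expect.
- by move=> y; exact: expect_ge0.
Qed.

Definition harmonic (h : borel X -> R) : Prop :=
  unit_fun h /\ forall x, ((h x)%:E = \int[p]_t (h (f (t, x)))%:E)%E.

Lemma harmonic_expect h n x : harmonic h -> (h x)%:E = expect n (EFin \o h) x.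
Proof.
move=> [[mh h1] hp].
have mh' : measurable_fun setT (EFin \o h) by exact/measurable_EFinP.
have h0 y : (0 <= (EFin \o h) y)%E by rewrite lee_fin; case/andP: (h1 y).
elim: n x => [|n IH] x; first by rewrite expect0.
by rewrite expectS// hp; apply: eq_integral => t _; exact: IH.
Qed.

Lemma harmonic_law h n x : harmonic h -> h x = (\int[law n x]_y h y)%R.
Proof.
move=> hh; have [[mh h1] _] := hh; apply: EFin_inj.
rewrite (harmonic_expect n x hh) expect_law//; first last.
- by move=> y; rewrite lee_fin; case/andP: (h1 y).
- exact/measurable_EFinP.
rewrite /Rintegral fineK//; apply: integrable_fin_num => //.
exact: unit_fun_integrable hh.1.
Qed.

Lemma measurable_fix x : measurable_fun setT (fun t => f (t, x)).
Proof. exact: (measurable_fun_pair1 x mf). Qed.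

Lemma unit_fun_comp (h : borel X -> R) x : unit_fun h -> unit_fun (fun t => h (f (t, x))).
Proof.
move=> [mh h1]; split=> [|t]; last exact: h1.
by apply: (measurableT_comp mh); exact: measurable_fix.
Qed.

Lemma harmonicC h : harmonic h -> harmonic (fun x => 1 - h x).
Proof.
move=> [uh hp]; have [mh h1] := uh; split.
  split; first by apply: measurable_funB => //; exact: measurable_cst.
  by move=> y; have /andP[? ?] := h1 y; apply/andP; split; lra.
move=> x; under eq_integral do rewrite EFinB.
rewrite integralB_EFin//.
- by rewrite integral_cst// [X in (_ * X)%E](probability_setT p) mule1 -hp EFinB.
- exact: (finite_measure_integrable_cst p 1 measurableT).
- exact: (unit_fun_integrable p (unit_fun_comp x uh)).
Qed.

(** Invariance gives [A (t :: w, x) <-> A (w, f (t, x))]; integrate over [w],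
then over [t]. *)
Lemma invariant_harmonic (A : set (sequence_space T * borel X)) :
  measurable A -> skew_product f @^-1` A = A ->
  harmonic (fun x => fine (P (ysection A x))).
Proof.
move=> mA FA.
have fP x : (fine (P (ysection A x)))%:E = P (ysection A x).
  by rewrite fineK//; apply: fin_num_measure; exact: measurable_ysection.
split; first split.
- apply: measurableT_comp => //; exact: measurable_fun_ysection.
- move=> x; rewrite -!lee_fin fP measure_ge0/=; apply: probability_le1.
  exact: measurable_ysection.
move=> x; rewrite fP (power_split P_power); last exact: measurable_ysection.
rewrite /product_measure1; apply: eq_integral => t _ /=; rewrite fP.
have FAE w y : A (skew_product f (w, y)) = A (w, y) by rewrite -[in RHS]FA.
congr (P _); apply/seteqP; split => w; rewrite /xsection /ysection /= !inE /= !inE.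
  by rewrite -(FAE (scons t w) x).
by rewrite -(FAE (scons t w) x).
Qed.

Definition closed_absorbing (C : set X) : Prop :=
  closed C /\ forall x, C x -> {ae p, forall t, C (f (t, x))}.

Lemma closed_absorbingT : closed_absorbing setT.
Proof. by split => [|x _]; [exact: closedT|exact: aeW]. Qed.

Lemma transition_absorbing C n x : closed_absorbing C -> C x ->
  transition P f n x C = 1%E.
Proof.
move=> [cC aC]; have mC := measurable_closed cC.
have mi : measurable_fun setT (EFin \o \1_C : borel X -> \bar R).
  by apply/measurable_EFinP; exact: measurable_indic.
rewrite -expect_indic//; elim: n x => [|n IH] x Cx.
  by rewrite expect0 /= indicE mem_set.
rewrite expectS//; last by move=> y; rewrite lee_fin.
rewrite (@ae_eq_integral _ _ _ p setT (cst 1%E)) ?integral_cst//.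
- by rewrite [X in (_ * X)%E](probability_setT p) mule1.
- apply: measurableT_comp; last exact: measurable_fix.
  by apply: measurable_expect => // y; rewrite lee_fin.
- by have := aC x Cx; apply: filterS => t Ct _; exact: IH.
Qed.

(** Maximum principle: at a point where [h] is maximal, the mean of the
nonnegative function [M - h] after one step is zero.  A bound on [C] is
enough, because the chain does not leave [C]. *)
Lemma argmax_absorbing C h M : closed_absorbing C -> harmonic h ->
  continuous (h : X -> R) -> (forall x, C x -> h x <= M) ->
  closed_absorbing (C `&` [set x | h x = M]).
Proof.
move=> [cC aC] [uh hp] ch hM; have [mh _] := uh; split.
  apply: closedI => //.
  by apply: (@preimage_closed _ _ (h : X -> R) [set M]) => //; exact: closed_eq.
move=> x [Cx /= hx].
have uhx := unit_fun_comp x uh.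
have ihx := unit_fun_integrable p uhx.
have icx : p.-integrable setT (EFin \o cst M).
  exact: (finite_measure_integrable_cst p M measurableT).
have icst : (\int[p]_t M%:E = M%:E)%E.
  by rewrite integral_cst// [X in (_ * X)%E](probability_setT p) mule1.
have : (\int[p]_t (`|M - h (f (t, x))|)%:E = 0)%E.
  rewrite (@ae_eq_integral _ _ _ p setT (fun t => (M - h (f (t, x)))%:E))//.
  - under eq_integral do rewrite EFinB.
    by rewrite (integralB_EFin measurableT icx ihx) [X in (X - _)%E]icst -hp hx subee.
  - apply/measurable_EFinP; apply: measurableT_comp => //.
    by apply: measurable_funB; [exact: measurable_cst|exact: uhx.1].
  - apply/measurable_EFinP.
    by apply: measurable_funB; [exact: measurable_cst|exact: uhx.1].
  - have := aC x Cx; apply: filterS => t Ct _.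
    by rewrite ger0_norm// subr_ge0 hM.
have := @ae_eq_integral_abs _ _ _ p setT measurableT (fun t => (M - h (f (t, x)))%:E).
case.
  apply/measurable_EFinP.
  by apply: measurable_funB; [exact: measurable_cst|exact: uhx.1].
move=> + _ => /[apply] ae0.
have := aC x Cx; apply: filterS2 ae0 => t /(_ I) [] /eqP.
by rewrite subr_eq0 => /eqP.
Qed.

Section ergodicity.
Variables (C : set X) (mu : probability (borel X) R).
Hypothesis aC : closed_absorbing C.
Hypothesis harmonic_cst : forall h, harmonic h -> exists c, forall x, C x -> h x = c.
Hypothesis smu : stationary p f mu.
Hypothesis muC : mu C = 1%E.

Lemma measurable_skew_product : measurable_fun setT (skew_product f).
Proof.
apply: measurable_fun_pair.
  apply: measurable_to_sequences => k.
  by apply: (measurableT_comp (measurable_coordinate k.+1)); exact: measurable_fst.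
apply: (measurableT_comp mf); apply: measurable_fun_pair.
  by apply: (measurableT_comp (measurable_coordinate 0)); exact: measurable_fst.
exact: measurable_snd.
Qed.

(** Split off the first coordinate, exchange the integrals over [t] and [w], and
apply stationarity to each section of [B]. *)
Lemma skew_product_invariant (B : set (sequence_space T * borel X)) :
  measurable B -> (P \x mu)%E (skew_product f @^-1` B) = (P \x mu)%E B.
Proof.
move=> mB.
have mFB : measurable (skew_product f @^-1` B).
  by rewrite -[X in measurable X]setTI; exact: measurable_skew_product.
rewrite /product_measure1 (power_integral P_power)//; last first.
  exact: (measurable_fun_xsection mu mFB).
pose g (z : T * sequence_space T) := mu [set x | xsection B z.2 (f (z.1, x))].
have mg : measurable_fun setT g.
  pose D : set ((T * sequence_space T) * borel X) :=
    (fun z => (z.1.2, f (z.1.1, z.2))) @^-1` B.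
  have mD : measurable D.
    rewrite -[X in measurable X]setTI.
    suff : measurable_fun setT (fun z : (T * sequence_space T) * borel X =>
      (z.1.2, f (z.1.1, z.2))) by apply.
    apply: measurable_fun_pair.
      by apply: measurableT_comp; [exact: measurable_snd|exact: measurable_fst].
    apply: (measurableT_comp mf); apply: measurable_fun_pair.
      by apply: measurableT_comp; [exact: measurable_fst|exact: measurable_fst].
    exact: measurable_snd.
  apply: (eq_measurable_fun (mu \o xsection D)); last first.
    exact: measurable_fun_xsection.
  move=> z _; rewrite /g /=.
  by congr (mu _); apply/seteqP; split => x; rewrite /xsection /= !inE.
transitivity (\int[p]_t \int[P]_w g (t, w))%E.
  apply: eq_integral => t _; apply: eq_integral => w _; rewrite /g /=.
  by congr (mu _); apply/seteqP; split => x; rewrite /xsection /= !inE.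
rewrite (fubini_tonelli g)//.
apply: eq_integral => w _; rewrite /g /= -smu//.
exact: measurable_xsection.
Qed.

(** Given the first [n] maps, membership in the invariant set [A] is decided by
the shifted sequence and the point reached, which is still in [C]; hence it has
conditional probability [c]. *)
Lemma invariant_cylinder A c n A' x :
  measurable A -> skew_product f @^-1` A = A ->
  (forall x, C x -> P (ysection A x) = c%:E) ->
  (forall k, measurable (A' k)) -> C x ->
  P (ysection A x `&` cylinder n A') = (c%:E * P (cylinder n A'))%E.
Proof.
move=> mA FA Pc; elim: n A' x => [|n IH] A' x mA' Cx.
  have -> : cylinder 0 A' = setT by apply/seteqP; split => // w _ k.
  by rewrite setIT Pc// [X in (_ * X)%E](probability_setT P) mule1.
have FAE w y : A (skew_product f (w, y)) = A (w, y) by rewrite -[in RHS]FA.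
have mcyl := measurable_cylinder n (fun k => mA' k.+1).
rewrite (power_split P_power); last first.
  by apply: measurableI; [exact: measurable_ysection|exact: measurable_cylinder].
have -> : P (cylinder n.+1 A') = (p (A' 0%N) * P (cylinder n (fun k => A' k.+1)))%E.
  rewrite [LHS]P_power// [X in (_ * X)%E]P_power// big_ord_recl//.
rewrite /product_measure1.
transitivity (\int[p]_t ((\1_(A' 0%N) t)%:E * (c%:E * P (cylinder n (fun k => A' k.+1)))))%E; last first.
  rewrite ge0_integralZr//.
  - by rewrite integral_indic// setIT muleCA.
  - by apply/measurable_EFinP; exact: measurable_indic.
  - by rewrite mule_ge0// -(Pc x Cx).
have sE t : (P \o xsection [set z | (ysection A x `&` cylinder n.+1 A') (scons z.1 z.2)]) t
   = ((\1_(A' 0%N) t)%:E * P (ysection A (f (t, x)) `&` cylinder n (fun k => A' k.+1)))%E.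
  rewrite indicE /=; case: (boolP (t \in A' 0%N)) => [/set_mem A't|/negP A't] /=.
    rewrite mul1e; congr (P _); apply/seteqP; split => w; rewrite /xsection /ysection /= !inE /= !inE.
      rewrite -(FAE (scons t w) x) => -[Aw cw]; split => // k kn.
      exact: (cw k.+1).
    rewrite -(FAE (scons t w) x) => -[Aw cw]; split => // -[|k] //= kn.
    exact: cw.
  rewrite mul0e (_ : xsection _ _ = set0) ?measure0//.
  apply/seteqP; split => w //; rewrite /xsection /= inE /= => -[_ cw].
  by apply: A't; apply/mem_set; exact: (cw 0%N).
apply: ae_eq_integral => //.
- apply: (measurable_fun_xsection P).
  rewrite -[X in measurable X]setTI; apply: measurable_scons => //.
  by apply: measurableI; [exact: measurable_ysection|exact: measurable_cylinder].
- apply: emeasurable_funM; last exact: measurable_cst.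
  by apply/measurable_EFinP; exact: measurable_indic.
have := aC.2 x Cx; apply: filterS => t Ct _.
by rewrite sE IH.
Qed.

(** Since cylinders generate, [P (A_x /\ B) = c * P B] extends from cylinders to
all measurable [B].  With [B := A_x] this gives [c = c * c]. *)
Lemma ergodic_on_absorbing : ergodic_stationary p P f mu.
Proof.
split => //; split => [B mB|A mA FA]; first exact: skew_product_invariant.
have [c hc] := harmonic_cst (invariant_harmonic mA FA).
have fP x : (fine (P (ysection A x)))%:E = P (ysection A x).
  by rewrite fineK//; apply: fin_num_measure; exact: measurable_ysection.
have Pc x : C x -> P (ysection A x) = c%:E by move=> Cx; rewrite -fP hc.
have [x0 Cx0] : C !=set0.
  apply/set0P/eqP => C0; move: muC; rewrite C0 measure0 => /eqP.
  by rewrite eq_sym onee_eq0.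
have mA0 : measurable (ysection A x0) by exact: measurable_ysection.
have c0 : 0 <= c by rewrite -(hc x0 Cx0) fine_ge0.
have cc : c = c * c.
  apply: EFin_inj; rewrite EFinM -{1 3}(Pc _ Cx0) -{1}[ysection A x0]setIid.
  apply: (@power_measure_unique _ _ _ (mrestr P mA0) (mscale (NngNum c0) P)) => //.
  - by rewrite /= /mrestr setTI (Pc _ Cx0) ltry.
  - move=> n A' mA'; rewrite /= /mscale /mrestr /= setIC.
    exact: (invariant_cylinder n mA FA Pc mA' Cx0).
rewrite (product_measure_swap P mu mA).
have -> : (\int[mu]_z P (ysection A z) = c%:E)%E.
  rewrite (@ae_eq_integral _ _ _ mu setT (cst c%:E))//.
  - by rewrite integral_cst// [X in (_ * X)%E](probability_setT mu) mule1.
  - exact: (measurable_fun_ysection P).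
  - exists (~` C); split.
    + by apply: measurableC; exact: measurable_closed aC.1.
    + by rewrite [LHS](probability_setC mu) ?[mu C]muC ?subee//; exact: measurable_closed aC.1.
    + by apply: subsetC => x Cx _; exact: Pc.
have : c * (c - 1) == 0 by rewrite mulrBr mulr1 -cc subrr.
by rewrite mulf_eq0 subr_eq0 => /orP[/eqP ->|/eqP ->]; [left|right].
Qed.

End ergodicity.
End markov.

(** * Total variation continuity on a compact space *)

Section strong_feller.
Context d (T : measurableType d) (R : realType) (X : ptopologicalType).
Variables (p : probability T R) (P : probability (sequence_space T) R).
Hypothesis P_power : is_power_measure p P.
Variable f : T * borel X -> borel X.
Hypothesis mf : measurable_fun setT f.
Hypothesis X_compact : compact [set: X].
Variable n0 : nat.
Notation law := (law P mf).
Notation expect := (expect P f).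

Definition tv_close (e : R) (x y : X) : Prop :=
  forall A : set (borel X), measurable A ->
    `|fine (law n0 x A) - fine (law n0 y A)| <= e.

Hypothesis tv_continuous : forall (x : X) (e : R), 0 < e ->
  \forall y \near x, tv_close e y x.

Lemma harmonic_continuous h : harmonic p f h -> continuous (h : X -> R).
Proof.
move=> hh x.
have hE : (h : X -> R) = fun y => (\int[law n0 y]_z h z)%R.
  by apply/funext => y; exact: (harmonic_law P_power).
rewrite /continuous_at hE.
apply: (@setwise_cvg_Rintegral _ _ _ X (nbhs x) _ (law n0) (law n0 x) h hh.1).
move=> A mA; apply/cvgrPdist_le => e e0.
by apply: filterS (tv_continuous x e0) => y; rewrite distrC; exact.
Qed.

(** Compactness of [X], in the form in which it is used: up to [e] in total
variation, the kernel has finitely many rows. *)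
Lemma finite_tv_net (e : R) : 0 < e ->
  exists s : seq X, forall x, exists2 z, z \in s & tv_close e x z.
Proof.
move=> e0; move: X_compact; rewrite compact_cover => cX.
have [||s _ sX] := cX X setT (fun z => interior [set y | tv_close e y z]).
- by move=> z _; exact: open_interior.
- by move=> x _; exists x => //; exact: tv_continuous.
exists (finmap.enum_fset s) => x; have [z zs xz] := sX x I.
by exists z => //; exact: interior_subset xz.
Qed.

Definition absorbing_family (r : nat) (C : 'I_r -> set X) : Prop :=
  (forall i, closed_absorbing p f (C i) /\ C i !=set0) /\
  (forall i j, i != j -> C i `&` C j = set0).

Lemma fine_law_absorbing C x : closed_absorbing p f C -> C x ->
  fine (law n0 x C) = 1.
Proof. by move=> aC Cx; rewrite lawE (transition_absorbing P_power mf). Qed.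

(** Send each member of the family to a row of a finite net that gives it mass
at least [3 / 4].  Two disjoint sets cannot share a row, as [3 / 4 + 3 / 4 > 1]. *)
Lemma absorbing_family_bound :
  exists N, forall r (C : 'I_r -> set X), absorbing_family C -> (r <= N)%N.
Proof.
have [//|s sX] := @finite_tv_net (1 / 4).
exists (size s) => r C [aC dC].
have /choice[k kC] : forall i : 'I_r, exists k : 'I_(size s),
    3 / 4 <= fine (law n0 (nth point s k) (C i)).
  move=> i; have [ai [x Cx]] := aC i.
  have [z zs xz] := sX x.
  have zi : (index z s < size s)%N by rewrite index_mem.
  exists (Ordinal zi); rewrite /= nth_index//.
  have := xz (C i) (measurable_closed ai.1).
  rewrite (fine_law_absorbing ai Cx) ler_norml => /andP[_ ?]; lra.
have kinj : injective k.
  move=> i j kij; apply/eqP/negPn/negP => /dC Cij.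
  have mi := measurable_closed (aC i).1.1; have mj := measurable_closed (aC j).1.1.
  have := probability_le1 (law n0 (nth point s (k i))) (measurableU _ _ mi mj).
  rewrite measureU// -[leLHS]fineK; last first.
    by rewrite fin_numD !fin_num_measure.
  rewrite lee_fin fineD ?fin_num_measure//.
  by have := kC i; have := kC j; rewrite -{}kij => ? ? ?; clear Cij; lra.
by have := leq_card k kinj; rewrite !card_ord.
Qed.

Lemma maximal_absorbing_family : exists r (C : 'I_r -> set X),
  absorbing_family C /\ forall D : 'I_r.+1 -> set X, ~ absorbing_family D.
Proof.
pose F r := `[< exists C : 'I_r -> set X, absorbing_family C >].
have F0 : exists r, F r.
  by exists 0%N; apply/asboolP; exists (fun=> set0); split => -[].
have [N FN] := absorbing_family_bound.
have FN' r : F r -> (r <= N)%N by move=> /asboolP[C]; exact: FN.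
case: (ex_maxnP F0 FN') => r /asboolP[C FC] rmax; exists r, C; split => // D FD.
have : F r.+1 by apply/asboolP; exists D.
by move=> /rmax; rewrite ltnn.
Qed.

(** Otherwise [K] could be added to the family.  This is stated for every family
[D] of maximal cardinality, so that it also applies after a member has been
replaced by a smaller one. *)
Lemma maximal_family_meets r (D : 'I_r -> set X) K :
  (forall D' : 'I_r.+1 -> set X, ~ absorbing_family D') ->
  absorbing_family D -> closed_absorbing p f K -> K !=set0 ->
  exists i, D i `&` K !=set0.
Proof.
move=> rmax [aD dD] aK K0; apply: contrapT => nDK.
have DK i : D i `&` K = set0.
  by apply: contrapT => /eqP/set0P DK0; apply: nDK; exists i.
(* The new member [K] receives the last index. *)
apply: (rmax (fun j => oapp D K (unlift ord_max j))); split.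
  by move=> j; case: unlift => [i|] /=; [exact: aD|split].
move=> i j; case: unliftP => [i'|] ->; case: unliftP => [j'|] -> //=.
- by rewrite (inj_eq (@lift_inj _ _)); exact: dD.
- by rewrite setIC.
- by rewrite eqxx.
Qed.

Definition indecomposable (C : set X) : Prop := forall K L,
  closed_absorbing p f K -> closed_absorbing p f L -> K !=set0 -> L !=set0 ->
  K `<=` C -> L `<=` C -> K `&` L !=set0.

(** If [K] and [L] were disjoint, replacing [C i] by [K] would leave room for
[L]. *)
Lemma maximal_family_indecomposable r (C : 'I_r -> set X) :
  (forall D' : 'I_r.+1 -> set X, ~ absorbing_family D') ->
  absorbing_family C -> forall i, indecomposable (C i).
Proof.
move=> rmax FC i K L aK aL K0 L0 KC LC; have [aC dC] := FC.
pose D j := if j == i then K else C j.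
have [|j] := maximal_family_meets rmax (D := D) _ aL L0.
  split=> [j|j k jk]; first by rewrite /D; case: ifP => _; [split|exact: aC].
  have sub j' : D j' `<=` C j'.
    by rewrite /D; case: eqP => [->//|_ x].
  by apply/seteqP; split => // x [/sub Cj /sub Ck]; rewrite -(dC j k jk).
rewrite /D; case: eqP => // /eqP ji [x [Cx Lx]]; exfalso.
have : (C j `&` C i) x by split => //; exact: LC.
by rewrite dC.
Qed.

(** The points of [C] where [h] is maximal and those where it is minimal are
closed absorbing subsets of [C], so they meet. *)
Lemma harmonic_constant C h : closed_absorbing p f C -> C !=set0 ->
  indecomposable C -> harmonic p f h -> exists c, forall x, C x -> h x = c.
Proof.
move=> aC C0 iC hh; have ch := harmonic_continuous hh.
have hh' := harmonicC mf hh; have ch' := harmonic_continuous hh'.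
have cC : compact C by apply: (subclosed_compact aC.1 X_compact).
have [a /set_mem Ca ha] := compact_EVT_max C0 cC (continuous_subspaceT ch).
have [b /set_mem Cb hb] := compact_EVT_min C0 cC (continuous_subspaceT ch).
have aa : closed_absorbing p f (C `&` [set x | h x = h a]).
  by apply: argmax_absorbing => // x Cx; apply: ha; exact/mem_set.
have ab : closed_absorbing p f (C `&` [set x | 1 - h x = 1 - h b]).
  apply: (argmax_absorbing mf aC hh' ch') => x Cx.
  by rewrite lerB// hb//; exact/mem_set.
have [||||x [[_ /= hxa] [_ /= hxb]]] := iC _ _ aa ab.
- by exists a.
- by exists b.
- exact: subIsetl.
- exact: subIsetl.
exists (h a) => y Cy; apply/eqP; rewrite eq_le ha ?inE//=.
have <- : h b = h a by rewrite -hxa; lra.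
by rewrite hb ?inE.
Qed.

Lemma expect_le_cst n h x (e : R) : measurable_fun setT h ->
  (forall y, 0 <= h y <= e%:E)%E -> (expect n h x <= e%:E)%E.
Proof.
move=> mh he.
have -> : e%:E = (\int[P]_w e%:E)%E.
  by rewrite integral_cst// [X in (_ * X)%E](probability_setT P) mule1.
apply: ge0_le_integral => //.
- by move=> w _; case/andP: (he (random_iterate f n w x)).
- by apply: (measurableT_comp mh); exact: measurable_random_iterate1.
- by move=> w _; case/andP: (he (random_iterate f n w x)).
Qed.

(** After time [n0] the law is a mixture of rows [P^n0 (y, .)], so it inherits
the bounds common to all of them. *)
Lemma law_late_le (A : set (borel X)) (e : R) k x : measurable A ->
  (forall y, fine (law n0 y A) <= e) -> fine (law (n0 + k) x A) <= e.
Proof.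
move=> mA Ae; rewrite -lee_fin fineK ?fin_num_measure//.
have mi : measurable_fun setT (EFin \o \1_A : borel X -> \bar R).
  by apply/measurable_EFinP; exact: measurable_indic.
have i0 y : (0 <= (EFin \o \1_A : borel X -> \bar R) y)%E by rewrite lee_fin.
rewrite lawE -(expect_indic P mf)// (expectD P_power)//.
apply: expect_le_cst => [|y]; first exact: measurable_expect.
rewrite expect_ge0//= (expect_indic P mf)// -(lawE P mf).
by rewrite -[leLHS]fineK ?fin_num_measure// lee_fin.
Qed.

(** Continuity at the empty set of the finitely many rows of a net is uniform,
and it carries over to all rows. *)
Lemma law_equicontinuous (A : (set (borel X))^nat) (e : R) :
  (forall j, measurable (A j)) -> nonincreasing_seq A -> \bigcap_j A j = set0 ->
  0 < e -> exists j, forall y, fine (law n0 y (A j)) <= e.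
Proof.
move=> mA niA capA e0.
have e2 : 0 < e / 2 by rewrite divr_gt0.
have [s sX] := finite_tv_net e2.
suff [j sj] : exists j, forall z, z \in s -> fine (law n0 z (A j)) <= e / 2.
  exists j => y; have [z zs yz] := sX y.
  have := sj z zs; have := yz (A j) (mA j).
  by rewrite ler_norml => /andP[_ ?] ?; lra.
suff : \forall j \near \oo, forall z, z \in s -> fine (law n0 z (A j)) <= e / 2.
  by move=> [N _ /(_ N (leqnn N)) HN]; exists N.
elim: s {sX} => [|z s IH]; first exact: nearW.
have zj : \forall j \near \oo, fine (law n0 z (A j)) <= e / 2.
  have : fine (law n0 z (A j)) @[j --> \oo] --> (0 : R).
    have cA : law n0 z \o A @ \oo --> (0 : R)%:E.
      have := @nonincreasing_cvg_mu _ _ _ (law n0 z) A.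
      rewrite capA measure0; apply => //.
      by rewrite (le_lt_trans (probability_le1 _ (mA 0%N)))// ltry.
    exact: (fine_cvg cA).
  move=> /cvgrPdist_le/(_ _ e2); apply: filterS => j.
  by rewrite sub0r normrN; apply: le_trans; exact: ler_norm.
apply: filterS2 zj IH => j zj IH z'.
by rewrite inE => /predU1P[->|/IH].
Qed.

(** The function [U 1_A]. *)
Definition one_step (A : set (borel X)) (x : borel X) : R :=
  fine (p (ysection (f @^-1` A) x)).

Let mpre (A : set (borel X)) : measurable A -> measurable (f @^-1` A).
Proof. by move=> mA; rewrite -[X in measurable X]setTI; exact: mf. Qed.

Let one_stepK A x : measurable A ->
  (one_step A x)%:E = p (ysection (f @^-1` A) x).
Proof.
by move=> mA; rewrite fineK// fin_num_measure//; apply: measurable_ysection; exact: mpre.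
Qed.

Lemma one_step_unit A : measurable A -> unit_fun (one_step A).
Proof.
move=> mA; split.
  by apply: measurableT_comp => //; apply: measurable_fun_ysection; exact: mpre.
move=> x; rewrite -!lee_fin one_stepK// measure_ge0/=; apply: probability_le1.
by apply: measurable_ysection; exact: mpre.
Qed.

Lemma one_step_expect A x : measurable A ->
  expect 1 (EFin \o \1_A) x = (one_step A x)%:E.
Proof.
move=> mA; have mi : measurable_fun setT (EFin \o \1_A : borel X -> \bar R).
  by apply/measurable_EFinP; exact: measurable_indic.
rewrite (expectS P_power)//; last by move=> y; rewrite lee_fin.
rewrite one_stepK//.
under eq_integral do rewrite expect0.
rewrite -[ysection _ _]setIT -integral_indic//; last first.
  by apply: measurable_ysection; exact: mpre.
apply: eq_integral => t _ /=; rewrite !indicE; congr ((nat_of_bool _)%:R%:E).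
by rewrite mem_ysection; apply/idP/idP; rewrite !inE.
Qed.

Lemma law_one_step A n x : measurable A ->
  (\int[law n x]_y one_step A y)%R = fine (law n.+1 x A).
Proof.
move=> mA; have mi : measurable_fun setT (EFin \o \1_A : borel X -> \bar R).
  by apply/measurable_EFinP; exact: measurable_indic.
rewrite [in RHS](lawE P mf) -(expect_indic P mf)// -add1n.
rewrite (expectD P_power)//; last by move=> y; rewrite lee_fin.
have -> : expect 1 (EFin \o \1_A) = EFin \o one_step A.
  by apply/funext => y; exact: one_step_expect.
rewrite (expect_law P mf)//; first by apply/measurable_EFinP; exact: (one_step_unit mA).1.
by move=> y; rewrite lee_fin; case/andP: ((one_step_unit mA).2 y).
Qed.

Lemma one_step_swap (mu : probability (borel X) R) A : measurable A ->
  (\int[mu]_y (one_step A y)%:E = \int[p]_t mu [set x | A (f (t, x))])%E.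
Proof.
move=> mA; under eq_integral do rewrite one_stepK//.
rewrite -(product_measure_swap p mu (mpre mA)) /product_measure1.
apply: eq_integral => t _ /=; congr (mu _).
by apply/seteqP; split => x; rewrite /xsection /= inE.
Qed.

(** Krylov-Bogoliubov argument with an ultralimit in place of a weak limit: the
averages start at time [n0], where the bounds on the rows apply. *)
Lemma stationary_on_absorbing (m : probability (borel X) R) C :
  (forall x A, measurable A -> m A = 0%E -> law n0 x A = 0%E) ->
  closed_absorbing p f C -> C !=set0 ->
  exists mu : probability (borel X) R,
    [/\ stationary p f mu, mu C = 1%E & mu `<< m].
Proof.
move=> lm aC [x0 Cx0].
pose nu k := law (n0 + k) x0.
pose ces n : probability (borel X) R := cesaro nu n.
have [G [GU oG]] := ultraFilterLemma (eventually_filter).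
have PG : ProperFilter G by exact: ultra_proper.
have late (A : set (borel X)) e : measurable A -> (forall y, fine (law n0 y A) <= e) ->
    forall n, fine (ces n A) <= e.
  move=> mA Ae n; rewrite cesaroE// mulrC ler_pdivrMr//.
  have -> : e * n.+1%:R = \sum_(k < n.+1) e.
    by rewrite sumr_const card_ord mulr_natr.
  by apply: ler_sum => k _; exact: law_late_le.
have [|mu numu] := @ultralimit_probability _ _ _ ces G GU.
  move=> A mA niA capA e e0.
  have [j Hj] := law_equicontinuous mA niA capA e0.
  by exists j => n; exact: late.
have muE (A : set (borel X)) (a : R) : measurable A ->
    fine (ces n A) @[n --> G] --> a -> mu A = a%:E.
  move=> mA /(cvg_unique _ (numu A mA)) <- //.
  by rewrite fineK// fin_num_measure.
exists mu; split.
- move=> A mA.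
  pose u k := fine (nu k A).
  have u01 k : 0 <= u k <= 1.
    rewrite fine_ge0//= -lee_fin fineK ?fin_num_measure//.
    exact: probability_le1.
  (* The sums telescope: averaging [U 1_A] instead of [1_A] only changes the
     two end terms. *)
  have cesS n : (\int[ces n]_y one_step A y)%R =
      fine (ces n A) + n.+1%:R^-1 * (u n.+1 - u 0%N).
    rewrite integral_cesaro; last exact: one_step_unit.
    rewrite cesaroE// -mulrDr; congr (_ * _).
    transitivity (\sum_(k < n.+1) u k.+1).
      by apply: eq_bigr => k _; rewrite law_one_step// -addnS.
    have : \sum_(k < n.+2) u k = \sum_(k < n.+2) u k by [].
    rewrite [LHS]big_ord_recl [RHS]big_ord_recr /=.
    rewrite (eq_bigr (fun k : 'I_n.+1 => u k.+1)) => [|k _]; last by [].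
    move=> /(canRL (addKr _)) ->; by rewrite addrCA [- _ + _]addrC.
  have small : n.+1%:R^-1 * (u n.+1 - u 0%N) @[n --> G] --> (0 : R).
    apply: (@cvg_trans _ (n.+1%:R^-1 * (u n.+1 - u 0%N) @[n --> \oo])).
      by apply: cvg_app; exact: oG.
    apply/cvgrPdist_le => e e0.
    have := near_infty_natSinv_lt (PosNum e0); apply: filterS => n /= ne.
    rewrite sub0r normrN normrM ger0_norm ?invr_ge0//.
    apply: le_trans (ltW ne); rewrite ler_piMr ?invr_ge0//.
    have := u01 n.+1; have := u01 0%N; rewrite ler_norml.
    by move=> /andP[? ?] /andP[? ?]; apply/andP; split; lra.
  have lim1 := setwise_cvg_Rintegral PG (one_step_unit mA) numu.
  have lim2 : (\int[ces n]_y one_step A y)%R @[n --> G] --> fine (mu A).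
    under eq_fun do rewrite cesS.
    by rewrite -[fine (mu A)]addr0; apply: cvgD => //; exact: numu.
  have muh : (\int[mu]_y one_step A y)%R = fine (mu A).
    exact: (cvg_unique _ lim1 lim2).
  rewrite -[LHS]fineK ?fin_num_measure// -muh /Rintegral fineK; last first.
    exact: (integrable_fin_num measurableT (unit_fun_integrable mu (one_step_unit mA))).
  by rewrite one_step_swap.
- apply: (muE _ 1); first exact: measurable_closed aC.1.
  rewrite (_ : (fun n => _) = fun=> 1); first exact: cvg_cst.
  apply/funext => n; rewrite cesaroE; last exact: measurable_closed aC.1.
  rewrite (eq_bigr (fun=> 1)) => [|k _]; first by rewrite sumr_const card_ord mulVf.
  by rewrite lawE (transition_absorbing P_power mf).
- apply/null_content_dominatesP => A mA mA0.
  apply: (muE _ 0) => //; rewrite (_ : (fun n => _) = fun=> 0); first exact: cvg_cst.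
  apply/funext => n; apply/eqP; rewrite eq_le fine_ge0// andbT.
  by apply: late => // y; rewrite lm.
Qed.

End strong_feller.

(** * Densities, time averages and basins *)

Lemma measurable_cvg_set d (Y : measurableType d) (R : realType)
    (u : nat -> Y -> R) (c : R) :
  (forall n, measurable_fun setT (u n)) ->
  measurable [set y | u n y @[n --> \oo] --> c].
Proof.
move=> mu.
have -> : [set y | u n y @[n --> \oo] --> c] =
    \bigcap_k \bigcup_N \bigcap_(n in [set n | (N <= n)%N])
      [set y | `|c - u n y| <= k.+1%:R^-1].
  apply/seteqP; split => y /=.
    move=> /cvgrPdist_le uc k _.
    have [|N _ HN] := uc k.+1%:R^-1; first by rewrite invr_gt0.
    by exists N => // n /= Nn; exact: HN.
  move=> uc; apply/cvgrPdist_le => e e0.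
  have [k ke] : exists k : nat, k.+1%:R^-1 < e.
    by have [k _ /(_ k (leqnn k))] := near_infty_natSinv_lt (PosNum e0); exists k.
  have [N _ HN] := uc k I; exists N => // n /= Nn.
  exact: le_trans (HN n Nn) (ltW ke).
apply: bigcapT_measurable => k; apply: bigcupT_measurable => N.
apply: bigcap_measurableType => n _; rewrite -[X in measurable X]setTI.
have mc : measurable_fun setT (fun y => `|c - u n y|).
  by apply: measurableT_comp => //; apply: measurable_funB => //; exact: measurable_cst.
exact: (measurable_fun_ler mc (measurable_cst _)).
Qed.

(** Dropping the first term does not change the limit of the means: the sets of
convergence are exactly invariant under the skew product, not only up to a null
set. *)
Lemma cvg_mean_shift (R : realType) (S S' : nat -> R) (a c : R) :
  (forall n, S n.+1 = a + S' n) ->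
  (n%:R^-1 * S n @[n --> \oo] --> c) <-> (n%:R^-1 * S' n @[n --> \oo] --> c).
Proof.
move=> SS'.
have h0 : n.+2%:R^-1 @[n --> \oo] --> (0 : R).
  by have := @cvg_harmonic R; rewrite -cvg_shiftS.
have h1 : n.+1%:R^-1 @[n --> \oo] --> (0 : R) by exact: cvg_harmonic.
split=> Sc.
- rewrite -(cvg_shiftS (fun n => n%:R^-1 * S' n)) /=.
  have -> : (fun n => n.+1%:R^-1 * S' n.+1) = (fun n =>
      (1 + n.+1%:R^-1) * (n.+2%:R^-1 * S n.+2) - n.+1%:R^-1 * a).
    apply/funext => n; rewrite SS'; field.
    by apply/andP; split.
  suff : (1 + n.+1%:R^-1) * (n.+2%:R^-1 * S n.+2) - n.+1%:R^-1 * a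
      @[n --> \oo] --> (1 + 0) * c - 0 * a.
    by rewrite addr0 mul1r mul0r subr0.
  apply: cvgB; last exact: cvgMr_tmp.
  apply: cvgM; first by apply: cvgD => //; exact: cvg_cst.
  by move: Sc; rewrite -(cvg_shiftn 2); under eq_fun do rewrite addn2.
- rewrite -(cvg_shiftn 2) /=.
  have -> : (fun n => (n + 2)%:R^-1 * S (n + 2)%N) = (fun n =>
      n.+2%:R^-1 * a + (1 - n.+2%:R^-1) * (n.+1%:R^-1 * S' n.+1)).
    apply/funext => n; rewrite addn2 SS'; field.
    by apply/andP; split.
  suff : n.+2%:R^-1 * a + (1 - n.+2%:R^-1) * (n.+1%:R^-1 * S' n.+1)
      @[n --> \oo] --> 0 * a + (1 - 0) * c.
    by rewrite subr0 mul1r mul0r add0r.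
  apply: cvgD; first exact: cvgMr_tmp.
  apply: cvgM; first by apply: cvgB => //; exact: cvg_cst.
  by move: Sc; rewrite -cvg_shiftS.
Qed.

(** The density has integral zero on every measurable subset of the complement
of [C], hence it vanishes there almost everywhere. *)
Lemma density_support_null (R : realType) (X : ptopologicalType)
    (m mu : probability (borel X) R) (C : set (borel X)) :
  mu `<< m -> measurable C -> mu C = 1%E ->
  m (density_support m mu `&` ~` C) = 0%E /\
  measurable (density_support m mu : set (borel X)).
Proof.
move=> mum mC muC.
pose rho := Radon_Nikodym (charge_of_finite_measure mu) m.
have irho : m.-integrable setT rho by exact: Radon_Nikodym_integrable.
have mrho : measurable_fun setT rho by exact: measurable_int irho.
have mS : measurable (density_support m mu : set (borel X)).
  rewrite (_ : density_support m mu = rho @^-1` (~` [set 0%E])).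
    by rewrite -[X in measurable X]setTI; apply: mrho => //; exact: measurableC.
  by apply/seteqP; split => x /= /eqP.
split => //.
have mNC : measurable (~` C) by exact: measurableC.
have rho0 : ae_eq m (~` C) rho (cst 0%E).
  apply: integral_ae_eq => //.
    exact: (integrableS measurableT).
  move=> E EC mE; rewrite integral_cst// mul0e.
  rewrite -[LHS](@Radon_Nikodym_integral _ _ _ (charge_of_finite_measure mu) m E mum mE).
  apply/eqP; rewrite eq_le measure_ge0 andbT.
  have <- : mu (~` C) = 0%E.
    by rewrite [LHS](probability_setC mu)// [mu C]muC subee.
  by apply: le_measure; rewrite ?inE.
have [N [mN N0 sN]] := rho0.
apply: (subset_measure0 _ mN) => //; first exact: measurableI.
by move=> x [/= Sx Cx]; apply: sN => /= /(_ Cx) H; move: Sx; rewrite /density_support /= -/rho H eqxx.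
Qed.

Lemma iter_skew_product d (T : measurableType d) (X : ptopologicalType)
    (f : T * borel X -> borel X) n z :
  iter n (skew_product f) z =
  ((fun k => z.1 (k + n)%N) : sequence_space T, random_iterate f n z.1 z.2 : borel X).
Proof.
elim: n => [|n IH] /=.
  by case: z => w x /=; congr (_, _); apply/funext => k; rewrite addn0.
rewrite IH /skew_product /=; congr (_, _).
by apply/funext => k; rewrite addSnnS.
Qed.

Lemma Rintegral_product_snd d1 d2 (Y : measurableType d1) (Z : measurableType d2)
    (R : realType) (nu : probability Y R) (mu : probability Z R) (h : Z -> R) b :
  measurable_fun setT h -> (forall z, `|h z| <= b) ->
  (\int[(nu \x mu)%E]_z h z.2 = \int[mu]_z h z)%R.
Proof.
move=> mh hb; congr fine.
have := @integral_pushforward _ _ _ _ _ snd (@measurable_snd _ _ Y Z) (nu \x mu)%E setT (EFin \o h).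
rewrite preimage_setT => <- //; last 2 first.
- exact/measurable_EFinP.
- apply: (@bounded_integrable _ _ _ _ _ b) => //.
  by apply: measurableT_comp => //; exact: measurable_snd.
apply: eq_measure_integral => A mA _; rewrite /pushforward.
transitivity ((nu \x mu)%E (setT `*` A)); first by rewrite setTX.
by rewrite product_measure1E// [X in (X * _)%E](probability_setT nu) mul1e.
Qed.

Lemma probability_ae1 d (Y : measurableType d) (R : realType)
    (nu : probability Y R) (A : set Y) :
  measurable A -> {ae nu, forall y, A y} -> nu A = 1%E.
Proof.
move=> mA [N [mN N0 sN]].
have nA0 : nu (~` A) = 0%E.
  by apply: (subset_measure0 _ mN) => //; exact: measurableC.
rewrite -[A]setCK [LHS](probability_setC nu); last exact: measurableC.
by rewrite [X in (_ - X)%E]nA0 sube0.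
Qed.

Section basins.
Context d (T : measurableType d) (R : realType) (X : ptopologicalType).
Variables (P : probability (sequence_space T) R).
Variable f : T * borel X -> borel X.
Hypothesis mf : measurable_fun setT f.
Variable psi : borel X -> R.
Hypothesis mpsi : measurable_fun setT psi.

Lemma birkhoff_sum_skew n z :
  birkhoff_sum (skew_product f) (psi \o snd) n z =
  \sum_(0 <= j < n) psi (random_iterate f j z.1 z.2).
Proof. by apply: eq_bigr => j _; rewrite /= iter_skew_product. Qed.

Definition convergence_set (c : R) : set (sequence_space T * borel X) :=
  [set z | n%:R^-1 * birkhoff_sum (skew_product f) (psi \o snd) n z
             @[n --> \oo] --> c].

Lemma measurable_convergence_set c : measurable (convergence_set c).
Proof.
apply: measurable_cvg_set => n; apply: measurable_funM; first exact: measurable_cst.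
apply: measurable_birkhoff_sum; first exact: measurable_skew_product.
by apply: measurableT_comp => //; exact: measurable_snd.
Qed.

Lemma convergence_set_invariant c :
  skew_product f @^-1` convergence_set c = convergence_set c.
Proof.
have shift z := @cvg_mean_shift R
  (fun n => birkhoff_sum (skew_product f) (psi \o snd) n z)
  (fun n => birkhoff_sum (skew_product f) (psi \o snd) n (skew_product f z))
  (psi z.2) c (fun n => birkhoff_sumS _ _ n z).
by apply/seteqP; split => z; have [] := shift z.
Qed.

Lemma basin_xsection (mu : probability (borel X) R) w :
  basin f mu psi w = xsection (convergence_set (\int[mu]_y psi y)%R) w.
Proof.
have bE x : (fun n : nat => n%:R^-1 *
    birkhoff_sum (skew_product f) (psi \o snd) n (w, x : borel X)) =
    (fun n => n%:R^-1 * \sum_(0 <= j < n) psi (random_iterate f j w x)).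
  by apply/funext => n; rewrite birkhoff_sum_skew.
by apply/seteqP; split => x;
  rewrite /xsection /basin /convergence_set /= inE /= bE.
Qed.

Lemma ergodic_convergence (p : probability T R) (mu : probability (borel X) R) :
  ergodic_stationary p P f mu -> bounded_fun psi ->
  (P \x mu)%E (convergence_set (\int[mu]_y psi y)%R) = 1%E.
Proof.
move=> [_ erg] bpsi.
have [b psib] : exists b, forall y, `|psi y| <= b.
  have [b [_ Hb]] := bpsi; exists (b + 1) => y.
  by apply: (Hb (b + 1)) => //; rewrite ltrDl.
have msnd : measurable_fun setT (psi \o snd : sequence_space T * borel X -> R).
  by apply: measurableT_comp => //; exact: measurable_snd.
have := birkhoff (measurable_skew_product mf) erg msnd (fun z => psib z.2).
rewrite (Rintegral_product_snd P mu mpsi psib) => ae1.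
exact: (probability_ae1 (measurable_convergence_set _) ae1).
Qed.

End basins.

Theorem theorem1 (R : realType) (X : ptopologicalType)
    (X_polish : polish R X) (X_compact : compact [set: X])
    (m : probability (borel X) R)
    (d : measure_display) (T : measurableType d) (p : probability T R)
    (P : probability (sequence_space T) R) (P_power : is_power_measure p P)
    (f : T * borel X -> borel X)
    (f_meas : measurable_fun [set: T * borel X] f)
    (n0 : nat) (n0_gt0 : (0 < n0)%N) (q : X -> X -> R)
    (q_L1 : forall x : X, m.-integrable [set: borel X] (EFin \o q x))
    (q_density : forall (x : X) (A : set (borel X)), measurable A ->
       transition P f n0 x A = (\int[m]_(y in A) (q x y)%:E)%E)
    (q_continuous : forall x : X,
       ('N[m]_1[EFin \o (q x' \- q x)%R])%E @[x' --> x] --> 0%E) :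
  FPM p P m f.
Proof.
have tv x (e : R) : 0 < e -> \forall y \near x, tv_close P f_meas n0 e y x.
  move=> e0; have /fine_cvgP[fin cv] := q_continuous x.
  move/cvgrPdist_le : cv => /(_ _ e0); apply: filterS2 fin => y fy.
  rewrite sub0r normrN /= => Ne A mA.
  rewrite !lawE !q_density//.
  have iS z : m.-integrable A (EFin \o q z) by exact: (integrableS measurableT).
  rewrite -fineB; [|exact: (integrable_fin_num mA (iS _))..].
  rewrite -integralB_EFin//.
  have iB : m.-integrable A (EFin \o (q y \- q x)) by exact: (integrableB mA (iS y) (iS x)).
  rewrite -lee_fin; apply: (@le_trans _ _ (\int[m]_(z in A) `|(q y z - q x z)%:E|)%E).
    have := le_abse_integral m mA (measurable_int m iB).
    by apply: le_trans; rewrite -abse_EFin fineK //; exact: (integrable_fin_num mA iB).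
  apply: (@le_trans _ _ ('N[m]_1[EFin \o (q y \- q x)%R])%E).
    rewrite Lnorm1; apply: ge0_subset_integral => //.
    apply: measurableT_comp => //.
    by apply: (measurable_int m); exact: (integrableB measurableT (q_L1 y) (q_L1 x)).
  rewrite -[leLHS]fineK// lee_fin; apply: le_trans Ne; exact: ler_norm.
have ac x A : measurable A -> m A = 0%E -> law P f_meas n0 x A = 0%E.
  move=> mA mA0; rewrite lawE q_density//; apply: null_set_integral => //.
  exact: (measurable_int m (integrableS measurableT mA (@subsetT _ _) (q_L1 x))).
have [r [C [FC rmax]]] := maximal_absorbing_family P_power X_compact tv.
have [aC dC] := FC.
have hcst i h : harmonic p f h -> exists c, forall x, C i x -> h x = c.
  have iC : indecomposable p f (C i) by exact: maximal_family_indecomposable FC _.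
  exact: (harmonic_constant P_power X_compact tv (aC i).1 (aC i).2 iC).
have /choice[mu muP] : forall i, exists mu : probability (borel X) R,
    [/\ stationary p f mu, mu (C i) = 1%E & mu `<< m].
  by move=> i; exact: (stationary_on_absorbing P_power X_compact tv ac (aC i).1 (aC i).2).
have mC i : measurable (C i : set (borel X)) := measurable_closed (aC i).1.1.
have erg i : ergodic_stationary p P f (mu i).
  have [si mi _] := muP i.
  exact: (ergodic_on_absorbing P_power f_meas (aC i).1 (hcst i) si mi).
exists r, mu; split => //; split; first by move=> i; have [] := muP i.
split.
  move=> i j ij; have [_ mui muim] := muP i; have [_ muj mujm] := muP j.
  have [Ni mSi] := density_support_null muim (mC i) mui.
  have [Nj mSj] := density_support_null mujm (mC j) muj.
  set Si : set (borel X) := density_support m (mu i) in Ni mSi *.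
  set Sj : set (borel X) := density_support m (mu j) in Nj mSj *.
  have mNi : measurable (Si `&` ~` C i).
    by apply: measurableI => //; exact: measurableC.
  have mNj : measurable (Sj `&` ~` C j).
    by apply: measurableI => //; exact: measurableC.
  apply: (@subset_measure0 _ _ _ m _ ((Si `&` ~` C i) `|` (Sj `&` ~` C j))).
  - exact: measurableI.
  - exact: measurableU.
  - move=> x [Six Sjx]; have [Cx|nCx] := pselect (C i x); [right|by left].
    split=> // Cjx; have : (C i `&` C j) x by [].
    by rewrite dC.
  - exact: null_set_setU.
move=> psi mpsi bpsi.
pose c i := (\int[mu i]_y psi y)%R.
pose B : set (sequence_space T * borel X) := \bigcup_i convergence_set f psi (c i).
have mB : measurable B.
  by apply: fin_bigcup_measurable => // i _; exact: measurable_convergence_set.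
have FB : skew_product f @^-1` B = B.
  rewrite /B preimage_bigcup; apply: eq_bigcupr => i _.
  exact: convergence_set_invariant.
pose h x := fine (P (ysection B x)).
have mBy x : measurable (ysection B x) by exact: measurable_ysection.
have hE x : (h x)%:E = P (ysection B x) by rewrite fineK// fin_num_measure.
have hh : harmonic p f h by exact: (invariant_harmonic P_power mB FB).
(* [h] is constant on [C i], and its mean for [mu i] is the mass [1] of [B]. *)
have hC i x : C i x -> h x = 1.
  have [a ha] := hcst i h hh => Cx; rewrite ha//.
  have : (P \x mu i)%E B = 1%E.
    apply/eqP; rewrite eq_le probability_le1//=.
    rewrite -(ergodic_convergence f_meas mpsi (erg i) bpsi).
    apply: le_measure; rewrite ?inE//; first exact: measurable_convergence_set.
    by move=> z Bz; exists i.
  rewrite (product_measure_swap P (mu i) mB).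
  rewrite (@ae_eq_integral _ _ _ (mu i) setT (cst a%:E))//.
  - by rewrite integral_cst// [X in (_ * X)%E](probability_setT (mu i)) mule1 => -[].
  - exact: (measurable_fun_ysection P).
  - exists (~` C i); split; first exact: measurableC.
      have [_ mui _] := muP i.
      by rewrite [LHS](probability_setC (mu i))// [mu i (C i)]mui subee.
    by apply: subsetC => y Cy _; rewrite -hE ha.
have h1 x : h x = 1.
  have ch := harmonic_continuous P_power tv hh.
  have [a _ ha] := compact_EVT_min (ex_intro _ point I) X_compact (continuous_subspaceT ch).
  have ah : closed_absorbing p f (setT `&` [set x | 1 - h x = 1 - h a]).
    apply: (argmax_absorbing f_meas (closed_absorbingT p f) (harmonicC f_meas hh)) => [|y _].
      exact: (harmonic_continuous P_power tv (harmonicC f_meas hh)).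
    by rewrite lerB// ha// inE.
  have [|i [y [Cy [_ /= hy]]]] := maximal_family_meets rmax FC ah; first by exists a.
  have /andP[_ hx1] := hh.1.2 x.
  apply/eqP; rewrite eq_le hx1/=.
  by have := ha x; rewrite inE => /(_ I); move: hy; rewrite (hC i y Cy); lra.
have PmB : (P \x m)%E B = 1%E.
  rewrite (product_measure_swap P m mB).
  under eq_integral do rewrite -hE h1.
  by rewrite integral_cst// [X in (_ * X)%E](probability_setT m) mule1.
have : (P \x m)%E (~` B) = 0%E.
  by rewrite [LHS](probability_setC (P \x m)%E)// [X in (_ - X)%E]PmB subee.
have mNB : measurable (~` B) by exact: measurableC.
rewrite /product_measure1 => int0.
have ae0 : ae_eq P setT (m \o xsection (~` B)) (cst 0%E).
  apply/ae_eq_integral_abs => //; first exact: (measurable_fun_xsection m mNB).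
  by rewrite -int0; apply: eq_integral => w _; rewrite gee0_abs.
apply: filterS ae0 => w /(_ I) /= w0.
rewrite (_ : \bigcup_i _ = xsection B w); last first.
  rewrite (eq_bigcupr (fun i _ => basin_xsection f psi (mu i) w)).
  apply/seteqP; split => x; rewrite /xsection /= inE.
    by move=> [i _]; rewrite /= inE => Bx; exists i.
  by move=> [i _ Bx]; exists i => //=; rewrite inE.
apply: probability_ae1; first exact: measurable_xsection.
exists (xsection (~` B) w); split => //; first exact: measurable_xsection.
by move=> x nB; apply/mem_set => Bx; apply: nB; exact/mem_set.
Qed.
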